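(* Let $\omega=(\omega_1,\omega_2,\ldots)\in\{0,1\}^{\mathbb{N}}$ be a Schnorr random sequence. For $n\ge 1$ define $$X_n=\frac{1}{\sqrt n}\left(2\sum_{i=n(n-1)/2+1}^{n(n+1)/2}\omega_i\;-\;n\right),$$ so that $X_1,X_2,X_3,\ldots$ use consecutive disjoint blocks of $\omega$ of lengths $1,2,3,\ldots$. For $k\ge 1$ let $\widehat D_k$ be the random variable assigning probability $1/k$ to each outcome $X_i$, $i=1,\ldots,k$ (counted with multiplicity), and let $\widehat F_k(t)=\frac1k\,\#\{i\le k: X_i\le t\}$, $t\in\mathbb{R}$, be its cumulative distribution function. Then: 1. For every $m\in\mathbb{N}_0$, $$\mathbb{E}\left[\widehat D_k^m\right]=\frac{X_1^m+X_2^m+\cdots+X_k^m}{k}\longrightarrow \nu_m\qquad\text{as }k\to\infty,$$ where $\nu_m$ is the $m$-th moment of the standard normal distribution. 2. The functions $\widehat F_k$ converge uniformly to the cumulative distribution function $\Phi$ of the standard normal distribution, i.e. $$\sup_{t\in\mathbb{R}}\left|\widehat F_k(t)-\Phi(t)\right|\longrightarrow 0\qquad\text{as }k\to\infty.$$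
   Context: Let $2^{\mathbb{N}}=\{0,1\}^{\mathbb{N}}$ be the Cantor space and, for a finite binary string $x$ of length $|x|$, let $\Omega_x\subset 2^{\mathbb{N}}$ be the cylinder of all infinite sequences with prefix $x$. Let $\lambda$ be the fair coin-tossing (Lebesgue) probability measure on $2^{\mathbb{N}}$, $\lambda(\Omega_x)=2^{-|x|}$. A set $U=\Omega_{x_1}\cup\Omega_{x_2}\cup\cdots$ is effectively open if the set of strings $\{x_1,x_2,\ldots\}$ is recursively enumerable. A sequence $(U_i)_{i\ge1}$ of effectively open sets is uniformly r.e. if there is an algorithm which, on input $i$, enumerates strings whose cylinders have union $U_i$. A Martin-Löf test is a uniformly r.e. sequence $(U_i)_{i\ge1}$ with $\lambda(U_i)\le 2^{-i}$ for all $i$. A Schnorr test is a Martin-Löf test for which the reals $\lambda(U_i)$ are uniformly computable in $i$ (there is an algorithm which on input $i$ and rational $\epsilon>0$ outputs a rational $r$ with $|r-\lambda(U_i)|<\epsilon$). A sequence $\omega\in 2^{\mathbb{N}}$ is Schnorr random if it does not belong to $\bigcap_i U_i$ for any Schnorr test $(U_i)$. The moments of the standard normal distribution are $\nu_m=0$ for $m$ odd and $\nu_m=(m-1)!!=(m-1)(m-3)\cdots 3\cdot 1$ for $m$ even (with $(-1)!!=1$). $\mathbb{N}_0$ denotes the nonnegative integers, and $0^0=1$. *)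

(* Defs.v *)
From HB Require Import structures.
From mathcomp Require Import all_boot all_order all_algebra.
From mathcomp Require Import all_classical all_reals all_analysis.
From mathcomp Require Import zify lra.
Set Implicit Arguments.
Unset Strict Implicit.
Unset Printing Implicit Defensive.
Import Order.TTheory GRing.Theory Num.Theory.
Import numFieldNormedType.Exports.
Local Open Scope classical_set_scope.
Local Open Scope ring_scope.

(* Algorithms: Kleene's partial recursive functions.  [recfun n] is the type
   of programs with [n] inputs, and [eval f v y] means that the program [f]
   halts on the inputs [v] with output [y]. *)

Inductive recfun : nat -> Type :=
| rf_zero n : recfun n
| rf_succ : recfun 1
| rf_proj n (i : 'I_n) : recfun n
| rf_comp m n (f : recfun m) (g : 'I_m -> recfun n) : recfun n
| rf_rec n (f : recfun n) (g : recfun n.+2) : recfun n.+1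
| rf_min n (f : recfun n.+1) : recfun n.

(* In [rf_rec] the first input is the recursion variable: the function [h]
   computed from the parameters [u] satisfies h 0 = f u and
   h k.+1 = g (k, h k, u).  In [rf_min] the first input of [f] is minimized. *)
Fixpoint eval n (f : recfun n) : n.-tuple nat -> nat -> Prop :=
  match f in recfun n return n.-tuple nat -> nat -> Prop with
  | rf_zero _ => fun _ y => y = 0%N
  | rf_succ => fun v y => y = (thead v).+1
  | rf_proj _ i => fun v y => y = tnth v i
  | rf_comp m _ f g => fun v y =>
      exists2 w : m.-tuple nat,
        (forall i, eval (g i) v (tnth w i)) & eval f w y
  | rf_rec n f g => fun v y =>
      let u : n.-tuple nat := [tuple of behead v] in
      exists h : nat -> nat,
        [/\ eval f u (h 0%N),
            (forall k, (k < thead v)%N ->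
               eval g [tuple of k :: h k :: u] (h k.+1))
          & y = h (thead v)]
  | rf_min _ f => fun v y =>
      eval f [tuple of y :: v] 0%N /\
      (forall k, (k < y)%N -> exists z, eval f [tuple of k :: v] z.+1)
  end.

Lemma eval_functional n (f : recfun n) v y z :
  eval f v y -> eval f v z -> y = z.
Proof.
elim: f v y z => {n} /=.
- by move=> n v y z -> ->.
- by move=> v y z -> ->.
- by move=> n i v y z -> ->.
- move=> m n f IHf g IHg v y z [w1 g1 f1] [w2 g2 f2].
  have w12 : w1 = w2 by apply: eq_from_tnth => i; exact: IHg (g1 i) (g2 i).
  by move: f1; rewrite w12 => /IHf; exact.
- move=> n f IHf g IHg v y z [h1 [f1 g1 ->]] [h2 [f2 g2 ->]].
  suff : forall k, (k <= thead v)%N -> h1 k = h2 k by apply.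
  elim=> [_|k IHk kv]; first exact: IHf f1 f2.
  by have := g1 k kv; rewrite (IHk (ltnW kv)) => /IHg; apply; exact: g2.
- move=> n f IHf v y z [y0 yS] [z0 zS].
  have [yz|zy|//] := ltngtP y z.
  + by have [t /IHf /(_ y0)] := zS y yz.
  + by have [t /IHf /(_ z0)] := yS z zy.
Qed.

(* Effective coding of strings: [str_code] is a bijection from binary strings
   onto the positive integers (the binary expansion with least significant
   digit first, followed by a final 1); 0 is not the code of a string. *)
Fixpoint str_code (x : seq bool) : nat :=
  if x is b :: s then (b + (str_code s).*2)%N else 1%N.

(* Sequences and strings are indexed from 0: the term omega_i with i >= 1 is
   [w i.-1]. *)
Definition cylinder (x : seq bool) : set (nat -> bool) :=
  [set w | forall i, (i < size x)%N -> w i = nth false x i].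

Definition cylinders : set (set (nat -> bool)) := range cylinder.

(* The Cantor space with its Borel sigma-algebra. *)
Definition cantor := g_sigma_algebraType cylinders.

Section coin_measure.
Variable R : realType.

(* The n-th digit after the binary point of t. *)
Definition binary_digits (t : measurableTypeR R) : cantor :=
  fun n => odd (Num.truncn (2 ^+ n.+1 * (t : R))).

Let measurable_trunc (c : R) (P : set nat) : 0 < c ->
  measurable [set t : measurableTypeR R | P (Num.truncn (c * (t : R)))].
Proof.
move=> c0.
have mle k : measurable
    [set t : measurableTypeR R | (Num.truncn (c * (t : R)) <= k)%N].
  rewrite (_ : [set t | _] = `]-oo, k.+1%:R / c[%classic).
    exact: measurable_itv.
  apply/seteqP; split => t /=;
    by rewrite in_itv/= truncn_le_nat ltr_pdivlMr// mulrC.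
rewrite (_ : [set t | _] = \bigcup_(k in P)
    [set t : measurableTypeR R | Num.truncn (c * (t : R)) = k]); last first.
  apply/seteqP; split => [t Pt|t [k Pk /= ->]//].
  by exists (Num.truncn (c * t)).
apply: bigcup_measurable => -[_|k _].
  rewrite (_ : [set t | _] =
      [set t : measurableTypeR R | (Num.truncn (c * (t : R)) <= 0)%N]) //.
  by apply/seteqP; split => t /=; rewrite leqn0 => /eqP.
rewrite (_ : [set t | _] =
    [set t : measurableTypeR R | (Num.truncn (c * (t : R)) <= k.+1)%N] `\`
    [set t : measurableTypeR R | (Num.truncn (c * (t : R)) <= k)%N]).
  exact: measurableD.
apply/seteqP; split => t /= => [->|[]]; first by rewrite ltnn; split.
by rewrite leq_eqVlt ltnS => /orP[/eqP//|->].
Qed.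

Lemma measurable_binary_digits :
  measurable_fun [set: measurableTypeR R] binary_digits.
Proof.
apply: (@measurability _ _ _ cantor _ _ cylinders) => //.
move=> _ [_ [x _ <-] <-]; rewrite setTI.
rewrite (_ : _ @^-1` _ = \bigcap_(i in [set i | (i < size x)%N])
    [set t : measurableTypeR R |
      [set k | odd k = nth false x i] (Num.truncn (2 ^+ i.+1 * (t : R)))]).
  apply: bigcap_measurableType => i _; apply: measurable_trunc.
  by rewrite exprn_gt0.
by apply/seteqP; split => t h i /h.
Qed.

HB.instance Definition _ :=
  isMeasurableFun.Build _ _ _ _ binary_digits measurable_binary_digits.

(* The fair coin-tossing measure, as the law of the binary digits of a uniform
   random real; see [coin_measure_cylinder]. *)
Definition coin_measure : probability cantor R :=
  distribution (uniform_prob (@ltr01 R)) binary_digits.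

Let truncn_half (y : R) : 0 <= y -> Num.truncn y = (Num.truncn (2 * y))./2.
Proof.
move=> y0; apply: truncn_def.
have /truncn_itv : 0 <= 2 * y by rewrite mulr_ge0.
set m := Num.truncn (2 * y) => /andP[].
rewrite -[in m%:R](odd_double_half m) -[in m.+1](odd_double_half m).
rewrite -addSn -muln2 !natrD !natrM -(@natr1 _ m./2).
have [b0 b1] : 0 <= (odd m)%:R :> R /\ (odd m).+1%:R <= 2 :> R.
  by rewrite ler0n ler_nat; case: (odd m).
by move=> h1 h2; apply/andP; split; lra.
Qed.

Let cylinder_trunc (x : seq bool) : exists2 k, (k < 2 ^ size x)%N &
  forall t : R, `[0, 1[%classic t ->
    cylinder x (binary_digits t) <-> Num.truncn (2 ^+ size x * t) = k.
Proof.
elim/last_ind: x => [|s b [k klt IH]].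
  exists 0%N => // t /=; rewrite in_itv/= expr0 mul1r => /andP[t0 t1].
  by split => // _; apply: truncn_def; rewrite t0.
exists (b + k.*2)%N.
  by rewrite size_rcons expnS; case: b; lia.
move=> t t01; have := t01; rewrite /= in_itv/= => /andP[t0 _].
rewrite size_rcons; have st0 : 0 <= 2 ^+ size s * t by rewrite mulr_ge0// exprn_ge0.
have -> : cylinder (rcons s b) (binary_digits t) <->
    cylinder s (binary_digits t) /\ odd (Num.truncn (2 ^+ (size s).+1 * t)) = b.
  split=> [h|[h1 h2] i].
    split=> [i si|].
      by have := h i; rewrite size_rcons nth_rcons si; apply; rewrite ltnW.
    by have := h (size s); rewrite size_rcons nth_rcons ltnn eqxx; apply.
  rewrite size_rcons nth_rcons ltnS leq_eqVlt => /orP[/eqP ->|si].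
    by rewrite ltnn eqxx.
  by rewrite si; exact: h1.
rewrite (IH t t01) (truncn_half st0) mulrA -exprS.
set m := Num.truncn _; split=> [[<- <-]|->]; first by rewrite odd_double_half.
by rewrite half_bit_double oddD odd_double addbF; case: (b).
Qed.

Lemma coin_measure_cylinder (x : seq bool) :
  coin_measure (cylinder x) = (2 ^- size x)%:E.
Proof.
have [k klt kP] := cylinder_trunc x.
have n0 : 0 < 2 ^+ size x :> R by rewrite exprn_gt0.
pose I : set R := `[k%:R / 2 ^+ size x, k.+1%:R / 2 ^+ size x[%classic.
pose A : set (measurableTypeR R) := binary_digits @^-1` cylinder x.
have mA : measurable A.
  rewrite -[A]setTI; apply: measurable_binary_digits => //.
  by apply: sub_sigma_algebra; exists x.
have AI : A `&` `[0, 1[ = I.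
  rewrite /I; apply/seteqP; split=> t.
    move=> [At t01]; have t0 : 0 <= t.
      by move: t01; rewrite /= in_itv/= => /andP[].
    have /truncn_itv : 0 <= 2 ^+ size x * t by rewrite mulr_ge0// ltW.
    rewrite ((kP t t01).1 At) /= in_itv/= ler_pdivrMr// ltr_pdivlMr//.
    by rewrite ![t * _]mulrC.
  rewrite /= in_itv/= ler_pdivrMr// ltr_pdivlMr// ![t * _]mulrC => tk.
  have t01 : `[0, 1[%classic t.
    rewrite /= in_itv/=; case/andP: tk => k1 k2; apply/andP; split.
      by rewrite -(pmulr_rge0 _ n0) (le_trans _ k1).
    rewrite -(ltr_pM2l n0) (lt_le_trans k2)// mulr1.
    by rewrite -natrX ler_nat.
  by split => //; apply/(kP t t01)/truncn_def.
rewrite /coin_measure/= /distribution /pushforward -/A /uniform_prob.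
rewrite integral_uniform_pdf (eq_integral (cst 1%:E)); last first.
  move=> t; rewrite inE => -[_ /=]; rewrite in_itv/= /uniform_pdf => ->.
  by rewrite subr0 invr1.
rewrite integral_cst ?mul1e; last first.
  by apply: measurableI => //; exact: measurable_itv.
have mI : (lebesgue_measure I = (2 ^- size x)%:E)%E.
  rewrite lebesgue_measure_itv/= lte_fin ltr_pM2r ?invr_gt0// ltr_nat ltnSn.
  by rewrite -EFinD -mulrBl -natr1 addrAC subrr add0r mul1r.
apply/eqP; rewrite eq_le -mI -AI; apply/andP; split; last first.
  apply: le_measure; rewrite ?inE; try by
    apply: measurableI => //; exact: measurable_itv.
  apply: setIS => t /=; rewrite !in_itv/= => /andP[-> /ltW].
  by [].
rewrite -[leRHS]adde0 -(lebesgue_measure_set1 (1 : R)).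
apply: (le_trans (y := lebesgue_measure ((A `&` `[0, 1[) `|` [set 1]))); last first.
  apply: measureU2 => //; apply: measurableI => //; exact: measurable_itv.
apply: le_measure; rewrite ?inE.
- by apply: measurableI => //; exact: measurable_itv.
- by apply: measurableU => //; apply: measurableI => //; exact: measurable_itv.
- move=> t [At /=]; rewrite in_itv/= => /andP[t0].
  rewrite le_eqVlt => /orP[/eqP ->|t1]; first by right.
  by left; split => //=; rewrite in_itv/= t0.
Qed.

End coin_measure.

Section schnorr.
Variable R : realType.

(* In a sequence (U_i) with i >= 1, the value at index 0 is irrelevant. *)

(* The program [e], run on i and on n = 0, 1, 2, ... (in parallel, as it need
   not halt), enumerates strings whose cylinders have union U_i. *)
Definition uniformly_re (U : nat -> set (nat -> bool)) : Prop :=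
  exists e : recfun 2, forall i, (0 < i)%N ->
    U i = \bigcup_(x in [set x | exists n, eval e [tuple i; n] (str_code x)])
            cylinder x.

(* A positive rational is given to an algorithm by its numerator and
   denominator; the rational output (a - b) / (c + 1) is presented by the
   triple of natural numbers (a, b, c). *)
Definition uniformly_computable (r : nat -> R) : Prop :=
  exists fa fb fc : recfun 3,
    forall (i : nat) (eps : rat), (0 < i)%N -> 0 < eps ->
      let v := [tuple i; `|numq eps|%N; `|denq eps|%N] in
      exists a b c : nat,
        [/\ eval fa v a, eval fb v b, eval fc v c &
            `| (a%:R - b%:R) / c.+1%:R - r i | < ratr eps].

Definition martin_lof_test (U : nat -> set (nat -> bool)) : Prop :=
  uniformly_re U /\
  forall i, (0 < i)%N -> (coin_measure R (U i) <= (2 ^- i)%:E)%E.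

Definition schnorr_test (U : nat -> set (nat -> bool)) : Prop :=
  martin_lof_test U /\
  uniformly_computable (fun i => fine (coin_measure R (U i))).

Definition schnorr_random (w : nat -> bool) : Prop :=
  forall U, schnorr_test U -> ~ (\bigcap_(i in [set i | (0 < i)%N]) U i) w.

End schnorr.

(* m!!, with 0!! = 1 *)
Fixpoint double_fact (m : nat) : nat :=
  if m is m'.+2 then (m * double_fact m')%N else 1%N.

(* (m - 1)!! for even m; for m = 0 this reads 0.-1 = 0 and 0!! = 1 = (-1)!!. *)
Definition nu (m : nat) : nat := if odd m then 0%N else double_fact m.-1.

Section empirical.
Variable R : realType.

(* X_n; the block of indices n(n-1)/2 + 1, ..., n(n+1)/2 counted from 1 is
   n(n-1)/2, ..., n(n+1)/2 - 1 counted from 0. *)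
Definition normalized_block_sum (w : nat -> bool) (n : nat) : R :=
  (Num.sqrt n%:R)^-1 *
  (2 * (\sum_((n * n.-1)./2 <= i < (n * n.+1)./2) (w i)%:R) - n%:R).

(* The law of the random variable D_k that takes the values X 1, ..., X k with
   probability 1/k each, counted with multiplicity. *)
Definition empirical_law (X : nat -> R) (k : nat)
    : {measure set R -> \bar R} :=
  mscale (k%:R^-1)%:nng (msum (fun i => \d_(X i.+1)) k).

Definition empirical_moment (X : nat -> R) (m k : nat) : R :=
  (\sum_(1 <= i < k.+1) X i ^+ m) / k%:R.

Definition empirical_cdf (X : nat -> R) (k : nat) (t : R) : R :=
  #|[set i : 'I_k | X i.+1 <= t]%SET|%:R / k%:R.

Definition normal_cdf (t : R) : R := fine (normal_prob 0 1 `]-oo, t]).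

End empirical.

(* Main.v *)
Require Import Defs.
From mathcomp Require Import all_boot all_order all_algebra.
From mathcomp Require Import all_classical all_reals all_analysis.
From mathcomp Require Import measurable_realfun.
From mathcomp Require Import zify ring lra.
Import Order.TTheory GRing.Theory Num.Theory.
Import numFieldNormedType.Exports.
Set Implicit Arguments.
Unset Strict Implicit.
Unset Printing Implicit Defensive.
Local Open Scope classical_set_scope.
Local Open Scope ring_scope.

(** Write S_i for the number of ones minus the number of zeros in the i-th
    block, so that X_i = S_i / sqrt i.  Under the coin-tossing measure the S_i are
    independent and S_i is the position of the simple random walk at time i.

    Moments.  Stein's identity for the walk,
    E[S_n g(S_n)] = n E[(g(S_(n-1) + 1) - g(S_(n-1) - 1)) / 2]  ([walk_stein]),
    applied to powers gives E[(S_n / sqrt n)^m] --> nu m ([cvg_walk_moment]).  By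
    independence the fourth moment of a centred sum of k bounded-moment block
    statistics is O(k^2) ([block_sum_moments]), so the event that the average of
    the first k values of X_i^m is further than 1/c from nu m has probability
    O(1/k^2).  The tails of this series have an explicit bound, so the unions of
    the tails form a Schnorr test as soon as each event is decidable
    ([schnorr_borel_cantelli]); hence a Schnorr random sequence is in finitely
    many of the events.  To make the events decidable by integer arithmetic
    ([integer_testE]), the irrational factor sqrt i ^ m is replaced by its integer
    part; the ratio tends to 1, which does not change the limit of the averages
    ([cvg_empirical_moment]).

    Distribution functions.  Only the convergence of the moments is used from
    here on.  The Taylor polynomials of a cosine approximate it with an error
    bounded by an even power, so the averages of cos (b + s X_i) converge to the
    Gaussian mean, and so do those of all trigonometric polynomials
    ([trig_converges]).  Products of trigonometric polynomials are again such, and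
    with v = (1 + sin (x / L)) / 2 the polynomial (1 - v^n)^M in v imitates a step,
    up to an error eps (1 + x^2) whose averages are controlled by the second
    moment ([trig_step]).  This squeezes the empirical distribution function
    between values of the normal one, and monotonicity with the Lipschitz
    continuity of the latter gives uniformity ([uniform_cvg_empirical_cdf]). *)

(** * Primitive recursive functions have programs *)
Section computable.
Local Open Scope nat_scope.

Definition computable n (F : n.-tuple nat -> nat) : Prop :=
  exists f : recfun n, forall v, Defs.eval f v (F v).

Definition tl n (v : n.+1.-tuple nat) : n.-tuple nat := [tuple of behead v].

Lemma tlK n k (u : n.-tuple nat) : tl [tuple of k :: u] = u.
Proof. exact: val_inj. Qed.

Lemma computable_ext n (F G : n.-tuple nat -> nat) :
  F =1 G -> computable F -> computable G.
Proof. by move=> /funext ->. Qed.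

Lemma computable_proj n (i : 'I_n) : computable (fun v => tnth v i).
Proof. by exists (rf_proj i). Qed.

Lemma computable_comp m n (F : m.-tuple nat -> nat)
    (G : 'I_m -> n.-tuple nat -> nat) :
  computable F -> (forall i, computable (G i)) ->
  computable (fun v => F [tuple G i v | i < m]).
Proof.
move=> [f fP] /boolp.choice[g gP]; exists (rf_comp f g) => v.
by exists [tuple G i v | i < m] => // i; rewrite tnth_mktuple.
Qed.

(** Together with [computable_head] this interprets de Bruijn variables: under a
    bounded quantifier or sum the bound variable is the head of the environment
    and the outer variables are found in its tail. *)
Lemma computable_weaken n (F : n.-tuple nat -> nat) :
  computable F -> computable (fun v : n.+1.-tuple nat => F (tl v)).
Proof.
move=> cF.
have := computable_comp cF (fun i => computable_proj (lift ord0 i)).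
apply: computable_ext => v; congr F; apply: eq_from_tnth => i.
rewrite tnth_mktuple tnth_behead.
suff -> : inord i.+1 = lift ord0 i by [].
by apply: val_inj; rewrite /= inordK ?ltnS ?ltn_ord.
Qed.

Lemma computable_head n : computable (fun v : n.+1.-tuple nat => thead v).
Proof. exact: computable_proj. Qed.

Lemma computable_succ n (F : n.-tuple nat -> nat) :
  computable F -> computable (fun v => (F v).+1).
Proof.
move=> [f fP]; exists (rf_comp rf_succ (fun=> f)) => v.
by exists [tuple F v]; rewrite //= => i; rewrite [i]ord1.
Qed.

Lemma computable_const n (c : nat) : computable (fun _ : n.-tuple nat => c).
Proof. by elim: c => [|c IH]; [exists (rf_zero n)|exact: computable_succ]. Qed.

(** The recursion operator takes its counter from the first input; composing it
    with H in that position gives a recursion of computable length. *)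
Lemma computable_iteri n (A H : n.-tuple nat -> nat)
    (G : n.-tuple nat -> nat -> nat -> nat) :
  computable H -> computable A ->
  computable (fun w : n.+2.-tuple nat => G (tl (tl w)) (thead w) (thead (tl w))) ->
  computable (fun v => iteri (H v) (G v) (A v)).
Proof.
move=> cH [a aP] [g gP].
have c0 : computable (fun w : n.+1.-tuple nat =>
    iteri (thead w) (G (tl w)) (A (tl w))).
  exists (rf_rec a g) => w; exists (fun k => iteri k (G (tl w)) (A (tl w))).
  split => //= k _.
  by have := gP [tuple of k :: iteri k (G (tl w)) (A (tl w)) :: tl w]; rewrite !tlK.
pose S i : n.-tuple nat -> nat :=
  if unlift ord0 i is Some j then fun v => tnth v j else H.
have cS i : computable (S i).
  by rewrite /S; case: unliftP => [j _|//]; exact: computable_proj.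
apply: computable_ext (computable_comp c0 cS) => v.
have -> : [tuple S i v | i < n.+1] = [tuple of H v :: v].
  apply: eq_from_tnth => i; rewrite tnth_mktuple /S; case: unliftP => [j ->|-> //].
  by rewrite tnthS.
by rewrite tlK.
Qed.

Lemma computable_add n (F G : n.-tuple nat -> nat) : computable F -> computable G ->
  computable (fun v => F v + G v).
Proof.
move=> cF cG; apply: (computable_ext (F := fun v => iteri (G v) (fun _ a => a.+1) (F v))).
  by move=> v; elim: (G v) => [|k /= ->]; rewrite ?addn0 ?addnS.
apply: computable_iteri => //; apply: computable_succ.
exact/computable_weaken/computable_head.
Qed.

Lemma computable_pred n (F : n.-tuple nat -> nat) : computable F -> computable (fun v => (F v).-1).
Proof.
move=> cF; apply: (computable_ext (F := fun v => iteri (F v) (fun k _ => k) 0)).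
  by move=> v; case: (F v).
by apply: computable_iteri => //; [exact: computable_const|exact: computable_head].
Qed.
Lemma computable_sub n (F G : n.-tuple nat -> nat) :
  computable F -> computable G -> computable (fun v => F v - G v).
Proof.
move=> cF cG; apply: (computable_ext (F := fun v => iteri (G v) (fun _ a => a.-1) (F v))).
  by move=> v; elim: (G v) => [|k /= ->]; rewrite ?subn0 ?subnS.
apply: computable_iteri => //; apply: computable_pred.
exact/computable_weaken/computable_head.
Qed.

Lemma computable_mul n (F G : n.-tuple nat -> nat) :
  computable F -> computable G -> computable (fun v => F v * G v).
Proof.
move=> cF cG; apply: (computable_ext (F := fun v => iteri (G v) (fun _ a => a + F v) 0)).
  by move=> v; elim: (G v) => [|k /= ->]; rewrite ?muln0 ?mulnS// addnC.
apply: computable_iteri => //; first exact: computable_const.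
apply: computable_add; first exact/computable_weaken/computable_head.
exact: (computable_weaken (computable_weaken cF)).
Qed.

Lemma computable_exp n (F G : n.-tuple nat -> nat) :
  computable F -> computable G -> computable (fun v => F v ^ G v).
Proof.
move=> cF cG; apply: (computable_ext (F := fun v => iteri (G v) (fun _ a => a * F v) 1)).
  by move=> v; elim: (G v) => [|k /= ->]; rewrite ?expn0 ?expnSr.
apply: computable_iteri => //; first exact: computable_const.
apply: computable_mul; first exact/computable_weaken/computable_head.
exact: (computable_weaken (computable_weaken cF)).
Qed.

Section bounded.
Variables (n : nat) (H : n.-tuple nat -> nat) (G : n.-tuple nat -> nat -> nat).
Hypothesis cH : computable H.
Hypothesis cG : computable (fun w : n.+1.-tuple nat => G (tl w) (thead w)).

(** The body of a sum or product, moved into the environment of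
    [computable_iteri], which has the accumulator as a second entry. *)
Let computable_body : computable (fun w : n.+2.-tuple nat => G (tl (tl w)) (thead w)).
Proof.
pose S i : n.+2.-tuple nat -> nat :=
  if unlift ord0 i is Some j then fun v => tnth (tl (tl v)) j else (fun v => thead v).
have cS i : computable (S i).
  rewrite /S; case: unliftP => [j _|_]; last exact: computable_head.
  exact: (computable_weaken (computable_weaken (computable_proj j))).
apply: computable_ext (computable_comp cG cS) => w.
have -> : [tuple S i w | i < n.+1] = [tuple of thead w :: tl (tl w)].
  apply: eq_from_tnth => i; rewrite tnth_mktuple /S; case: unliftP => [j ->|-> //].
  by rewrite tnthS.
by rewrite tlK.
Qed.

Lemma computable_sum : computable (fun v => \sum_(0 <= k < H v) G v k).
Proof.
apply: (computable_ext (F := fun v => iteri (H v) (fun k a => a + G v k) 0)).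
  move=> v; elim: (H v) => [|k /= ->]; first by rewrite big_geq.
  by rewrite big_nat_recr.
apply: computable_iteri => //; first exact: computable_const.
by apply: computable_add => //; apply/computable_weaken/computable_head.
Qed.

Lemma computable_prod : computable (fun v => \prod_(0 <= k < H v) G v k).
Proof.
apply: (computable_ext (F := fun v => iteri (H v) (fun k a => a * G v k) 1)).
  move=> v; elim: (H v) => [|k /= ->]; first by rewrite big_geq.
  by rewrite big_nat_recr.
apply: computable_iteri => //; first exact: computable_const.
by apply: computable_mul => //; apply/computable_weaken/computable_head.
Qed.
End bounded.

Definition decidable_pred n (b : n.-tuple nat -> bool) : Prop :=
  computable (fun v => b v : nat).

Section logic.
Variable n : nat.
Implicit Types (F G : n.-tuple nat -> nat) (b c : n.-tuple nat -> bool).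

Lemma decidable_leq F G : computable F -> computable G ->
  decidable_pred (fun v => F v <= G v).
Proof.
move=> cF cG; apply: (computable_ext (F := fun v => 1 - (F v - G v))).
  by move=> v; rewrite -subn_eq0; case: (F v - G v).
by apply: computable_sub; [exact: computable_const|exact: computable_sub].
Qed.

Lemma decidable_and b c : decidable_pred b -> decidable_pred c ->
  decidable_pred (fun v => b v && c v).
Proof.
move=> cb cc; apply: computable_ext (computable_mul cb cc) => v.
by rewrite mulnb.
Qed.

Lemma decidable_not b : decidable_pred b -> decidable_pred (fun v => ~~ b v).
Proof.
move=> cb; apply: computable_ext (computable_sub (computable_const n 1) cb) => v.
by case: (b v).
Qed.

Lemma decidable_or b c : decidable_pred b -> decidable_pred c ->
  decidable_pred (fun v => b v || c v).
Proof.
move=> cb cc; rewrite /decidable_pred.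
under [X in computable X]eq_fun do rewrite -[_ || _]negbK negb_or.
by apply: decidable_not; apply: decidable_and; apply: decidable_not.
Qed.

End logic.

Lemma decidable_has n (F : n.-tuple nat -> nat) (b : n.-tuple nat -> nat -> bool) : computable F ->
  decidable_pred (fun w : n.+1.-tuple nat => b (tl w) (thead w)) ->
  decidable_pred (fun v => has (b v) (iota 0 (F v))).
Proof.
move=> cF cb.
have -> : (fun v => has (b v) (iota 0 (F v))) =
    (fun v => 1 <= \sum_(0 <= k < F v) b v k).
  apply/funext => v; rewrite has_count -sumn_count /index_iota subn0.
  by rewrite sumnE big_map.
apply: decidable_leq; first exact: computable_const.
exact: computable_sum.
Qed.

(** The quotient of F by a positive G is the number of q below F with
    (q + 1) G <= F. *)
Lemma computable_div n (F G : n.-tuple nat -> nat) : computable F -> computable G ->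
  computable (fun v => F v %/ G v).
Proof.
move=> cF cG.
apply: (computable_ext (F := fun v =>
    \sum_(0 <= q < F v) ((1 <= G v) && (q.+1 * G v <= F v)))).
  move=> v /=; set m := F v; set d := G v.
  have [->|d0] := posnP d; first by rewrite divn0 big1.
  rewrite (eq_bigr (fun q => (q < m %/ d) : nat)); last first.
    by move=> q _; rewrite /= leq_divRL.
  rewrite (big_cat_nat (n := m %/ d)) ?leq_div//=.
  rewrite big_nat_cond (eq_bigr (fun=> 1)); last first.
    by move=> i /andP[/andP[_ i1] _]; rewrite i1.
  rewrite -big_nat_cond sum_nat_const_nat subn0 muln1 big_nat_cond big1 ?addn0//.
  by move=> i /andP[/andP[i0 _] _]; rewrite ltnNge i0.
apply: computable_sum => //; apply: decidable_and.
  by apply: decidable_leq; [exact: computable_const|exact: computable_weaken].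
apply: decidable_leq; last exact: computable_weaken.
by apply: computable_mul; [exact/computable_succ/computable_head|exact: computable_weaken].
Qed.

Lemma decidable_odd n (F : n.-tuple nat -> nat) : computable F ->
  decidable_pred (fun v => odd (F v)).
Proof.
move=> cF; apply: (computable_ext (F := fun v => F v - 2 * (F v %/ 2))).
  by move=> v; rewrite divn2 mul2n -[in X in X - _](odd_double_half (F v)) addnK.
apply: computable_sub => //; apply: computable_mul; first exact: computable_const.
by apply: computable_div => //; exact: computable_const.
Qed.
End computable.

(** * The coin-tossing measure of events that depend on finitely many bits *)
Section string_average.
Variable R : realType.
Implicit Types (N : nat) (f g : seq bool -> R).

(** The mean over the strings of length N, as a recursion on N so that the
    independence of disjoint blocks, [string_avg_cat], is immediate. *)
Fixpoint string_avg N f : R :=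
  if N is N'.+1 then
    (string_avg N' (fun x => f (true :: x)) + string_avg N' (fun x => f (false :: x))) / 2
  else f [::].

Lemma eq_string_avg N f g : (forall x, size x = N -> f x = g x) -> string_avg N f = string_avg N g.
Proof.
elim: N f g => [|N IH] f g fg /=; first exact: fg.
by congr ((_ + _) / 2); apply: IH => x xN; apply: fg; rewrite /= xN.
Qed.

Lemma string_avgD N f g : string_avg N (fun x => f x + g x) = string_avg N f + string_avg N g.
Proof. by elim: N f g => [//|N IH] f g /=; rewrite !IH; ring. Qed.

Lemma string_avgZ N (c : R) f : string_avg N (fun x => c * f x) = c * string_avg N f.
Proof. by elim: N f => [//|N IH] f /=; rewrite !IH; ring. Qed.

Lemma string_avg_cst N (c : R) : string_avg N (fun=> c) = c.
Proof. by elim: N => [//|N /= ->]; field. Qed.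

Lemma le_string_avg N f g : (forall x, f x <= g x) -> string_avg N f <= string_avg N g.
Proof.
elim: N f g => [|N IH] f g fg /=; first exact: fg.
by rewrite ler_pM2r ?invr_gt0// lerD// IH.
Qed.

Lemma string_avg_ge0 N f : (forall x, 0 <= f x) -> 0 <= string_avg N f.
Proof. by move=> f0; rewrite -(string_avg_cst N 0); exact: le_string_avg. Qed.

Lemma string_avg_cat M N f :
  string_avg (M + N) f = string_avg M (fun x => string_avg N (fun y => f (x ++ y))).
Proof. by elim: M f => [//|M IH] f; rewrite addSn /= !IH. Qed.

Definition depends_on N (T : (nat -> bool) -> bool) : Prop :=
  forall w w', (forall i, (i < N)%N -> w i = w' i) -> T w = T w'.

Lemma measurable_cylinder x : measurable (cylinder x : set cantor).
Proof. by apply: sub_sigma_algebra; exists x. Qed.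

Lemma cylinder_split x :
  cylinder x = cylinder (rcons x true) `|` cylinder (rcons x false).
Proof.
apply/seteqP; split => w /=.
  move=> xw; case wx : (w (size x)); [left|right] => i;
  by rewrite size_rcons nth_rcons ltnS leq_eqVlt => /orP[/eqP->|ix];
    rewrite ?ltnn ?eqxx ?ix //; exact: xw.
by case=> xw i ix; have := xw i; rewrite size_rcons nth_rcons ix => -> //;
  rewrite ltnS ltnW.
Qed.

(** Splitting a cylinder into its two halves is the recursion step of
    [string_avg]; measurability is obtained along the way. *)
Let coin_measure_prefix M x T : depends_on (size x + M) T ->
  measurable (cylinder x `&` [set w | T w] : set cantor) /\
  coin_measure R (cylinder x `&` [set w | T w]) =
    (2 ^- size x * string_avg M (fun y => (T (nth false (x ++ y)))%:R))%:E.
Proof.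
elim: M x => [|M IH] x Tdep.
  have -> : cylinder x `&` [set w | T w] = if T (nth false x) then cylinder x else set0.
    rewrite addn0 in Tdep.
    case: ifP => Tx; apply/seteqP; split => w //=; first by case.
      move=> xw; split => //; rewrite -[is_true _]/(T w = true) -Tx.
      exact: Tdep.
    by case=> xw; rewrite (Tdep w (nth false x)) ?Tx.
  case Tx : (T _); split; rewrite /= ?cats0 ?Tx ?mulr1 ?mulr0 ?measure0//.
    exact: measurable_cylinder.
  exact: coin_measure_cylinder.
have Tr b : depends_on (size (rcons x b) + M) T by rewrite size_rcons addSnnS.
have [mt et] := IH _ (Tr true); have [mf ef] := IH _ (Tr false).
rewrite cylinder_split setIUl; split; first exact: measurableU.
rewrite measureU//; last first.
  apply/seteqP; split => w //= [[xt _] [xf _]].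
  have := xf (size x); have := xt (size x).
  by rewrite !size_rcons !nth_rcons ltnn eqxx => -> // /(_ (ltnSn _)).
transitivity (coin_measure R (cylinder (rcons x true) `&` [set w | T w]) +
  coin_measure R (cylinder (rcons x false) `&` [set w | T w]))%E; first by [].
rewrite et ef -EFinD; congr EFin; rewrite !size_rcons exprS /=.
under eq_string_avg do rewrite cat_rcons.
under [X in _ + _ * X]eq_string_avg do rewrite cat_rcons.
by rewrite invfM; ring.
Qed.

Lemma measurable_depends_on N T : depends_on N T ->
  measurable ([set w | T w] : set cantor).
Proof.
move=> Tdep; have [] := @coin_measure_prefix N [::] T Tdep.
by rewrite (_ : cylinder [::] = setT) ?setTI//; apply/seteqP; split.
Qed.

Lemma coin_measure_depends_on N T : depends_on N T ->
  coin_measure R [set w | T w] = (string_avg N (fun x => (T (nth false x))%:R))%:E.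
Proof.
move=> Tdep; have [_] := @coin_measure_prefix N [::] T Tdep.
rewrite (_ : cylinder [::] = setT) ?setTI; last by apply/seteqP; split.
by rewrite expr0 invr1 mul1r.
Qed.

End string_average.

Definition bit (n i : nat) : bool := odd (n %/ 2 ^ i).

(** [str_code] prepends a bit b to a string of code n by n |-> b + 2 n. *)
Lemma bit_double (b : bool) n i :
  bit (b + n.*2) i = if i is i'.+1 then bit n i' else b.
Proof.
case: i => [|i]; rewrite /bit ?expn0 ?divn1 ?oddD ?odd_double ?addbF ?oddb//.
by rewrite expnS divnMA divn2 half_bit_double.
Qed.

Lemma bit_str_code x i : (i < size x)%N -> bit (str_code x) i = nth false x i.
Proof.
by elim: x i => [//|b x IH] [|i] ix; rewrite /= bit_double//; exact: IH.
Qed.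

Lemma str_code_bounds x : (2 ^ size x <= str_code x < 2 ^ (size x).+1)%N.
Proof.
elim: x => [//|b x] /=; rewrite !expnS => /andP[x1 x2].
by case: b; lia.
Qed.

Lemma sum_double (R : nmodType) (f : nat -> R) M :
  \sum_(0 <= j < M.*2) f j = \sum_(0 <= j < M) (f j.*2.+1 + f j.*2).
Proof.
elim: M => [|M IH]; first by rewrite !big_geq.
by rewrite doubleS !big_nat_recr//= IH -!addrA [f _ + f _]addrC.
Qed.

(** The bits of the numbers below 2^N run through all strings of length N, so
    measures of clopen sets can be computed by counting numbers. *)
Lemma string_avg_sum_bit (R : realType) N (G : (nat -> bool) -> R) :
  string_avg N (fun x => G (nth false x)) = (\sum_(0 <= j < 2 ^ N) G (bit j)) / 2 ^+ N.
Proof.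
elim: N G => [|N IH] G.
  rewrite expn0 expr0 big_nat1 divr1 /=; congr G; apply/funext => i.
  by rewrite nth_nil /bit div0n.
pose cons_bit b (w : nat -> bool) i := if i is i'.+1 then w i' else b.
have nthE b x : nth false (b :: x) = cons_bit b (nth false x).
  by apply/funext => -[].
rewrite /=; under eq_string_avg do rewrite nthE.
under [X in _ + X]eq_string_avg do rewrite nthE.
rewrite (IH (G \o cons_bit true)) (IH (G \o cons_bit false)) expnS mul2n sum_double.
rewrite exprS big_split/= invfM -mulrDl -mulrA [2^-1 * _]mulrC.
congr ((_ + _) * _); apply: eq_bigr => j _; congr G; apply/funext => i.
  by rewrite -[j.*2.+1]/(true + j.*2)%N bit_double.
by rewrite -[j.*2]/(false + j.*2)%N bit_double.
Qed.

(** * An effective Borel-Cantelli lemma for Schnorr randomness *)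
Section computable_composition.
Local Open Scope nat_scope.

Lemma computable_comp1 n (f : nat -> nat) (A : n.-tuple nat -> nat) :
  computable (fun v : 1.-tuple nat => f (thead v)) -> computable A ->
  computable (fun v => f (A v)).
Proof.
move=> cf cA; apply: computable_ext (computable_comp cf (fun=> cA)) => v.
by rewrite /thead tnth_mktuple.
Qed.

Lemma computable_comp2 n (F : nat -> nat -> nat) (A B : n.-tuple nat -> nat) :
  computable (fun v : 2.-tuple nat => F (thead v) (thead (tl v))) ->
  computable A -> computable B -> computable (fun v => F (A v) (B v)).
Proof.
move=> cF cA cB.
have cAB i : computable (fun v => if i == ord0 :> 'I_2 then A v else B v).
  by case: (i == ord0).
apply: computable_ext (computable_comp cF cAB) => v.
rewrite /thead tnth_mktuple eqxx tnth_behead tnth_mktuple.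
by rewrite ifF//; apply/negbTE; rewrite -val_eqE /= inordK.
Qed.

End computable_composition.

(** Descends through an arithmetical expression, leaving as goals the
    subexpressions built from other functions. *)
Ltac computability := cbv beta; lazymatch goal with
| |- decidable_pred _ => rewrite /decidable_pred; computability
| |- computable (@thead _ _) => exact: computable_head
| |- computable (fun v => thead _) =>
    first [exact: computable_head
      | exact: (computable_weaken (@computable_head _))
      | exact: (computable_weaken (computable_weaken (@computable_head _)))
      | exact: (computable_weaken (computable_weaken (computable_weaken (@computable_head _))))
      | exact: (computable_weaken (computable_weaken (computable_weaken (computable_weaken
          (@computable_head _)))))
      | exact: (computable_weaken (computable_weaken (computable_weaken (computable_weaken
          (computable_weaken (@computable_head _))))))]
| |- computable (fun v => (@?F v).+1) =>
    apply: (@computable_succ _ F); computability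
| |- computable (fun v => (@?F v + @?G v)%N) =>
    apply: (@computable_add _ F G); computability
| |- computable (fun v => (@?F v - @?G v)%N) =>
    apply: (@computable_sub _ F G); computability
| |- computable (fun v => (@?F v * @?G v)%N) =>
    apply: (@computable_mul _ F G); computability
| |- computable (fun v => (@?F v ^ @?G v)%N) =>
    apply: (@computable_exp _ F G); computability
| |- computable (fun v => (@?F v %/ @?G v)%N) =>
    apply: (@computable_div _ F G); computability
| |- computable (fun v => (@?F v).-1) =>
    apply: (@computable_pred _ F); computability
| |- computable (fun v => nat_of_bool (@?F v <= @?G v)%N) =>
    apply: (@decidable_leq _ F G); computability
| |- computable (fun v => nat_of_bool (@?b v && @?c v)) =>
    apply: (@decidable_and _ b c); computability
| |- computable (fun v => nat_of_bool (@?b v || @?c v)) =>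
    apply: (@decidable_or _ b c); computability
| |- computable (fun v => nat_of_bool (~~ @?b v)) =>
    apply: (@decidable_not _ b); computability
| |- computable (fun v => nat_of_bool (odd (@?F v))) =>
    apply: (@decidable_odd _ F); computability
| |- computable (fun v => nat_of_bool (has (@?b v) (iota 0 (@?F v)))) =>
    apply: (@decidable_has _ F b); computability
| |- computable (fun v => (\sum_(0 <= k < @?F v) @?G v k)%N) =>
    apply: (@computable_sum _ F G); computability
| |- computable (fun v => (\prod_(0 <= k < @?F v) @?G v k)%N) =>
    apply: (@computable_prod _ F G); computability
| |- computable (fun v => ?c) => try exact: computable_const
| |- _ => idtac
end.

Lemma computable_program2 (F : nat -> nat -> nat) :
  computable (fun v : 2.-tuple nat => F (thead v) (thead (tl v))) ->
  exists e : recfun 2, forall i n y, Defs.eval e [tuple i; n] y <-> y = F i n.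
Proof.
move=> [e eP]; exists e => i n y; have /= := eP [tuple i; n].
rewrite /thead !tnth0 => ein; split=> [|-> //].
by move=> /eval_functional /(_ ein).
Qed.

Section borel_cantelli.
Variables (R : realType) (T : nat -> (nat -> bool) -> bool) (len : nat -> nat).
Variables (c k0 : nat).
Hypothesis len_ge : forall k, (k <= len k)%N.
Hypothesis len_homo : forall m n, (m <= n)%N -> (len m <= len n)%N.
Hypothesis T_dep : forall k, depends_on (len k) (T k).
Hypothesis computable_len : computable (fun v : 1.-tuple nat => len (thead v)).
Hypothesis decidable_T :
  decidable_pred (fun v : 2.-tuple nat => T (thead v) (bit (thead (tl v)))).
Hypothesis string_avg_T : forall k, (k0 <= k)%N -> (0 < k)%N ->
  string_avg (len k) (fun x => (T k (nth false x))%:R) <= c%:R / (k%:R * k.+1%:R) :> R.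

Let C k : set (nat -> bool) := [set w | T k w].
Let tail K := \bigcup_(k in [set k | (K <= k)%N]) C k.

Let measurable_C k : measurable (C k : set cantor).
Proof. exact: (measurable_depends_on R (@T_dep k)). Qed.

Let measurable_tail K : measurable (tail K : set cantor).
Proof. by apply: bigcup_measurable => k _; exact: measurable_C. Qed.

(** The bound c / (k (k + 1)) telescopes, so the tail from K on has measure at
    most c / K. *)
Let tail_measure K : (k0 <= K)%N -> (0 < K)%N ->
  (coin_measure R (tail K) <= (c%:R / K%:R)%:E)%E.
Proof.
move=> k0K K0.
apply: (@le_trans _ _ (\sum_(0 <= n <oo) coin_measure R (C (K + n)%N)))%E.
  apply: measure_sigma_subadditive => //.
  move=> w [k /= Kk Ckw]; exists (k - K)%N => //=; by rewrite subnKC.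
apply: lime_le; first exact: is_cvg_nneseries.
apply: nearW => n.
apply: (@le_trans _ _ (\sum_(0 <= i < n) (c%:R / ((K + i)%:R * (K + i).+1%:R) : R)%:E)%E).
  apply: lee_sum => i _; rewrite (coin_measure_depends_on _ (@T_dep _)) lee_fin.
  by apply: string_avg_T; lia.
rewrite sumEFin lee_fin.
suff -> : \sum_(0 <= i < n) (c%:R / ((K + i)%:R * (K + i).+1%:R) : R) =
    c%:R / K%:R - c%:R / (K + n)%:R by rewrite gerBl divr_ge0.
elim: n => [|n IH]; first by rewrite big_geq// addn0 subrr.
rewrite big_nat_recr//= IH -addrA addnS; congr (_ + _).
have /gt_eqF/negbT h : 0 < (K + n)%:R :> R by rewrite ltr0n; lia.
have h' : 1 + (K + n)%:R != 0 :> R by rewrite nat1r pnatr_eq0.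
have h'' : K%:R != 0 :> R by rewrite pnatr_eq0 -lt0n.
rewrite -nat1r; move: h h' h''; move: (_%:R) (K%:R) (c%:R) => x y z x0 x1 y0.
by field; rewrite x0 x1.
Qed.

Let B := (k0 + c).+1.
(** The factor B > c gives c / level i <= 2^-i. *)
Let level i := (B * 2 ^ i)%N.

Let level_gt0 i : (0 < level i)%N.
Proof. by rewrite muln_gt0 expn_gt0. Qed.

Let level_ge i : (k0 <= level i)%N.
Proof. by apply: leq_trans (leq_pmulr _ _); rewrite ?expn_gt0 /B//; lia. Qed.

(** The program that enumerates the i-th set of the test: given n it answers n
    itself if n codes a string of length [len k] on which T k holds, for some k
    at least [level i], and otherwise 0, which is not the code of a string. *)
Let enum i n : nat :=
  if has (fun k => [&& (level i <= k)%N, (2 ^ len k <= n)%N, (n < 2 ^ (len k).+1)%N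
                     & T k (bit n)]) (iota 0 n) then n else 0.

(** Only the events below [level i + c * q] are examined: the remaining ones have
    measure less than 1 / q. *)
Let count i q : nat :=
  (\sum_(0 <= j < 2 ^ len (level i + c * q))
     has (fun k => (level i <= k)%N && T k (bit j)) (iota 0 (level i + c * q)))%N.

Let decidable_comp_T n (A D : n.-tuple nat -> nat) :
  computable A -> computable D -> computable (fun v => T (A v) (bit (D v)) : nat).
Proof. exact: (@computable_comp2 _ (fun k j => T k (bit j) : nat) A D decidable_T). Qed.

Let computable_comp_len n (A : n.-tuple nat -> nat) :
  computable A -> computable (fun v => len (A v)).
Proof. exact: (@computable_comp1 _ len A computable_len). Qed.

Let computable_enum :
  computable (fun v : 2.-tuple nat => enum (thead v) (thead (tl v))).
Proof.
rewrite /enum /level.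
under [X in computable X]eq_fun => v.
  rewrite (_ : (if _ then _ else _) = (has (fun k => [&& (B * 2 ^ thead v <= k)%N,
    (2 ^ len k <= thead (tl v))%N, (thead (tl v) < 2 ^ (len k).+1)%N
                     & T k (bit (thead (tl v)))]) (iota 0 (thead (tl v)))
    * thead (tl v))%N); last by case: ifP; rewrite ?mul1n ?mul0n.
  over.
computability.
- by apply: computable_comp_len; computability.
- by apply: computable_comp_len; computability.
- by apply: decidable_comp_T; computability.
Qed.

Let computable_count :
  computable (fun v : 3.-tuple nat => count (thead v) (thead (tl (tl v)))).
Proof.
rewrite /count /level; computability.
- by apply: computable_comp_len; computability.
- by apply: decidable_comp_T; computability.
Qed.

Let computable_denominator : computable (fun v : 3.-tuple nat =>
  (2 ^ len (level (thead v) + c * thead (tl (tl v)))).-1).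
Proof.
by rewrite /level; computability; apply: computable_comp_len; computability.
Qed.

Let head_test i K w := has (fun k => (level i <= k)%N && T k w) (iota 0 K).

Let head_testP i K w :
  reflect (exists k, [/\ (level i <= k)%N, (k < K)%N & T k w]) (head_test i K w).
Proof.
apply: (iffP hasP) => [[k]|[k [ik kK Tk]]].
  by rewrite mem_iota add0n => /= kK /andP[ik Tk]; exists k.
by exists k; rewrite ?mem_iota ?ik.
Qed.

Let head_test_dep i K : depends_on (len K) (head_test i K).
Proof.
move=> w w' ww'; apply: eq_in_has => k; rewrite mem_iota add0n => /= kK.
by rewrite (@T_dep k w w')// => j jk; apply: ww'; apply: leq_trans jk (len_homo (ltnW kK)).
Qed.

Let head_measure i q : coin_measure R [set w | head_test i (level i + c * q) w] =
  ((count i q)%:R / 2 ^+ len (level i + c * q))%:E.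
Proof.
rewrite (coin_measure_depends_on _ (@head_test_dep i _)).
rewrite (string_avg_sum_bit _ (fun w => (head_test i (level i + c * q) w)%:R)).
by rewrite /count natr_sum.
Qed.

(** The finite union has the measure [head_measure], and what it misses is
    contained in the tail from [level i + c * q] on. *)
Let approximation i q : (0 < q)%N ->
  `|(count i q)%:R / 2 ^+ len (level i + c * q) - fine (coin_measure R (tail (level i)))|
    < q%:R^-1 :> R.
Proof.
move=> q0; set K := (level i + c * q)%N.
have fin (A : set cantor) : measurable A -> coin_measure R A \is a fin_num.
  by move=> mA; exact: fin_num_measure.
have mV : measurable ([set w | head_test i K w] : set cantor).
  exact: (measurable_depends_on R (@head_test_dep i K)).
have VU : fine (coin_measure R [set w | head_test i K w]) <=
    fine (coin_measure R (tail (level i))).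
  apply: fine_le; rewrite ?fin//; apply: le_measure; rewrite ?inE//.
  by move=> w /head_testP[k [ik _ Tk]]; exists k.
have UV : fine (coin_measure R (tail (level i))) <=
    fine (coin_measure R [set w | head_test i K w]) + fine (coin_measure R (tail K)).
  rewrite -fineD ?fin//; apply: fine_le.
  - exact: fin.
  - by rewrite fin_numD; apply/andP; split; exact: fin.
  apply: (@le_trans _ _ (coin_measure R
    (([set w | head_test i K w] : set cantor) `|` tail K))); last exact: measureU2.
  apply: le_measure; rewrite ?inE//; first exact: measurableU.
  move=> w [k /= ik Tk]; have [kK|Kk] := ltnP k K; last by right; exists k.
  by left; apply/head_testP; exists k.
have tK : fine (coin_measure R (tail K)) < q%:R^-1.
  have K0 : (0 < K)%N by rewrite addn_gt0 level_gt0.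
  apply: (@le_lt_trans _ _ (c%:R / K%:R)).
    rewrite -lee_fin fineK ?fin//; apply: tail_measure => //.
    exact: leq_trans (level_ge i) (leq_addr _ _).
  rewrite ltr_pdivrMr ?ltr0n// mulrC ltr_pdivlMr ?ltr0n// -natrM ltr_nat.
  by rewrite -[X in (X < _)%N]add0n ltn_add2r level_gt0.
rewrite head_measure -/K in VU UV.
rewrite ler0_norm ?subr_le0// opprB ltrBlDl; apply: le_lt_trans UV _.
by rewrite ltrD2l.
Qed.

(** The codes from 2^(len k) up to 2^(len k + 1) are those of the strings of length
    [len k], so the digits of such a code determine T k on the whole cylinder. *)
Let tail_enum i e : (forall i n y, Defs.eval e [tuple i; n] y <-> y = enum i n) ->
  tail (level i) =
  \bigcup_(x in [set x | exists n, Defs.eval e [tuple i; n] (str_code x)]) cylinder x.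
Proof.
move=> eP; apply/seteqP; split => w.
  move=> [k /= ik Tk]; pose x := mkseq w (len k).
  have sx : size x = len k by rewrite size_mkseq.
  have xw : cylinder x w by move=> j; rewrite sx => jk; rewrite nth_mkseq.
  exists x => //=; exists (str_code x); apply/eP; rewrite /enum ifT//.
  have /andP[x1 x2] := str_code_bounds x; rewrite sx in x1 x2.
  apply/hasP; exists k.
    rewrite mem_iota add0n leq0n /=.
    exact: leq_ltn_trans (len_ge k) (leq_trans (ltn_expl _ (ltnSn 1)) x1).
  rewrite ik x1 x2 /= (@T_dep k _ w)// => j jk.
  by rewrite bit_str_code ?sx// nth_mkseq.
move=> [x [n /eP]]; rewrite /enum; case: ifPn => [/hasP[k _]|_]; last first.
  by move=> x0; have /andP[] := str_code_bounds x; rewrite x0 leqn0 expn_eq0.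
move=> /and4P[ik n1 n2 Tk] nx xw; exists k => //=; rewrite -nx in n1 n2 Tk.
rewrite /C /= (@T_dep k _ (bit (str_code x)))// => j jk.
have sk : size x = len k.
  have /andP[x1 x2] := str_code_bounds x; apply/eqP; rewrite eqn_leq.
  rewrite -ltnS -(ltn_exp2l _ _ (ltnSn 1)) (leq_ltn_trans x1 n2).
  by rewrite -[(len k <= _)%N]ltnS -(ltn_exp2l _ _ (ltnSn 1)) (leq_ltn_trans n1 x2).
by rewrite bit_str_code ?sk//; apply: xw; rewrite sk.
Qed.

Let tail_test : schnorr_test R (fun i => tail (level i)).
Proof.
split; first split.
- have [e eP] := computable_program2 computable_enum.
  by exists e => i _; exact: tail_enum.
- move=> i _; apply: le_trans (tail_measure (level_ge i) (level_gt0 i)) _.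
  rewrite lee_fin ler_pdivrMr ?ltr0n ?level_gt0// mulrC ler_pdivlMr ?exprn_gt0//.
  by rewrite /level natrM natrX ler_pM2r ?exprn_gt0// ler_nat /B; lia.
have [fa faP] := computable_count.
have [fc fcP] := computable_denominator.
(* The precision is at least the inverse of its denominator. *)
exists fa, (rf_zero 3), fc => i eps i0 eps0 v.
exists (count i `|denq eps|), 0%N, (2 ^ len (level i + c * `|denq eps|)).-1.
split => //.
rewrite subr0 prednK ?expn_gt0// natrX.
have q0 : (0 < `|denq eps|)%N by rewrite absz_gt0 denq_neq0.
apply: lt_le_trans (approximation i q0) _.
rewrite -{2}[eps]divq_num_den rmorphM/= fmorphV/= !ratr_int.
rewrite natr_absz gtr0_norm ?denq_gt0// ler_peMl ?invr_ge0 ?ler0z ?denq_ge0//.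
by rewrite ler1z -gtz0_ge1 numq_gt0.
Qed.

Lemma schnorr_borel_cantelli (omega : nat -> bool) : schnorr_random R omega ->
  exists K, forall k, (K <= k)%N -> ~~ T k omega.
Proof.
move=> /(_ _ tail_test) notin; apply/not_existsP => h; apply: notin => i _.
have /existsNP[k /not_implyP[ik /negP/negPn Tk]] := h (level i).
by exists k.
Qed.

End borel_cantelli.

(** * Moments of the simple random walk *)
Lemma cvg_exprn (R : realType) (u : nat -> R) (l : R) m :
  u n @[n --> \oo] --> l -> u n ^+ m @[n --> \oo] --> l ^+ m.
Proof.
move=> ul; elim: m => [|m IH]; first by rewrite expr0; exact: cvg_cst.
by rewrite exprS; under eq_fun do rewrite exprS; exact: cvgM.
Qed.

Lemma cvg_sum_ord (R : realType) k (u : 'I_k -> nat -> R) (l : 'I_k -> R) :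
  (forall j, u j n @[n --> \oo] --> l j) ->
  \sum_(j < k) u j n @[n --> \oo] --> \sum_(j < k) l j.
Proof.
elim: k u l => [|k IH] u l ul.
  by rewrite big_ord0; under eq_fun do rewrite big_ord0; exact: cvg_cst.
rewrite big_ord_recl; under eq_fun do rewrite big_ord_recl.
by apply: cvgD => //; apply: IH => j; exact: ul.
Qed.

Section walk.
Variable R : realType.
Implicit Types (n m : nat) (g h : R -> R).

(** The expectation of g at the position of the simple random walk at time n,
    by conditioning on the last step. *)
Fixpoint walk n g : R :=
  if n is n'.+1 then walk n' (fun x => (g (x + 1) + g (x - 1)) / 2) else g 0.

Lemma eq_walk n g h : g =1 h -> walk n g = walk n h.
Proof. by move=> /funext ->. Qed.

Lemma walkD n g h : walk n (fun x => g x + h x) = walk n g + walk n h.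
Proof.
elim: n g h => [//|n IH] g h /=; rewrite -IH; apply: eq_walk => x.
by rewrite -mulrDl addrACA.
Qed.

Lemma walkZ n (c : R) g : walk n (fun x => c * g x) = c * walk n g.
Proof.
elim: n g => [//|n IH] g /=; rewrite -IH; apply: eq_walk => x.
by rewrite -mulrDr mulrA.
Qed.

Lemma walk_sum n k (F : 'I_k -> R -> R) :
  walk n (fun x => \sum_(j < k) F j x) = \sum_(j < k) walk n (F j).
Proof.
elim: k F => [|k IH] F.
  rewrite big_ord0; under eq_walk do rewrite big_ord0 -[0](mul0r 0).
  by rewrite walkZ mul0r.
by under eq_walk do rewrite big_ord_recl; rewrite walkD IH big_ord_recl.
Qed.

Definition steps (y : seq bool) : R := \sum_(b <- y) (if b then 1 else -1).

Lemma string_avg_steps n g : string_avg n (fun y => g (steps y)) = walk n g.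
Proof.
elim: n g => [|n IH] g /=; first by rewrite /steps big_nil.
under eq_string_avg do rewrite /steps big_cons -/(steps _) addrC.
under [X in _ + X]eq_string_avg do rewrite /steps big_cons -/(steps _) addrC.
rewrite (IH (fun x => g (x + 1))) (IH (fun x => g (x - 1))) mulrC -walkD -walkZ.
by apply: eq_walk => x; rewrite mulrC.
Qed.

(** Stein's identity, the discrete analogue of E[Z g(Z)] = E[g'(Z)] for a
    standard normal Z.  It is stated for all g so that the induction can replace g
    by its average over the last step. *)
Lemma walk_stein n g : walk n.+1 (fun x => x * g x) =
  n.+1%:R * walk n (fun x => (g (x + 1) - g (x - 1)) / 2).
Proof.
elim: n g => [|n IH] g; first by rewrite /= mul1r; ring.
pose h x := (g (x + 1) + g (x - 1)) / 2; pose D x := (g (x + 1) - g (x - 1)) / 2.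
transitivity (walk n.+1 (fun x => x * h x + D x)).
  rewrite -[LHS]/(walk n.+1 (fun x => ((x + 1) * g (x + 1) + (x - 1) * g (x - 1)) / 2)).
  by apply: eq_walk => x; rewrite /h /D; field.
rewrite walkD IH -/D -[n.+2%:R]natr1 mulrDl mul1r; congr (_ * _ + _).
by apply: eq_walk => x; rewrite /h /D !addrK !subrK; field.
Qed.

(** In the Stein identity for g(x) = x^(m+1) the leading term dominates after
    normalization; the coefficients of the lower powers are left unspecified. *)
Lemma central_difference_expansion m : exists c : 'I_m -> R, forall x : R,
  ((x + 1) ^+ m.+1 - (x - 1) ^+ m.+1) / 2 =
    m.+1%:R * x ^+ m + \sum_(j < m) c j * x ^+ j.
Proof.
exists (fun j => 'C(m.+1, j)%:R * (1 - (-1) ^+ (m.+1 - j)) / 2) => x.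
rewrite exprD1n [x - 1]addrC exprDn -sumrB mulr_suml big_ord_recr big_ord_recr/=.
rewrite subnn expr0 mul1r subrr mul0r addr0 subSnn expr1 addrC; congr (_ + _).
  by rewrite -(@bin_sub m.+1 m)// subSnn bin1 mulN1r mulNrn opprK -mulr_natl; field.
apply: eq_bigr => j _; rewrite -[X in X - _]mulr_natl -[X in _ - X]mulr_natl.
by move: ('C(m.+1, j)%:R : R) ((-1) ^+ (m.+1 - j) : R) (x ^+ j) => a b d; ring.
Qed.

Definition walk_moment m n : R := walk n (fun x => x ^+ m) / Num.sqrt n%:R ^+ m.

Lemma cvg_sqrt_ratio :
  (Num.sqrt n%:R / Num.sqrt n.+1%:R : R) @[n --> \oo] --> (1 : R).
Proof.
have -> : (fun n => Num.sqrt n%:R / Num.sqrt n.+1%:R : R) =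
    (fun n => Num.sqrt (1 - n.+1%:R^-1)).
  apply/funext => n; rewrite -sqrtrV// -sqrtrM//; congr Num.sqrt.
  by rewrite -(natr1 n); field; rewrite natr1 pnatr_eq0.
rewrite -[X in _ --> X]sqrtr1 -[X in Num.sqrt X]subr0.
apply: continuous_cvg; first exact: sqrt_continuous.
by apply: cvgB; [exact: cvg_cst|exact: cvg_harmonic].
Qed.

Lemma cvg_inv_sqrt : ((Num.sqrt n.+1%:R)^-1 : R) @[n --> \oo] --> (0 : R).
Proof.
have -> : (fun n => (Num.sqrt n.+1%:R)^-1 : R) = (fun n => Num.sqrt n.+1%:R^-1).
  by apply/funext => n; rewrite sqrtrV.
rewrite -[X in _ --> X](sqrtr0 R).
apply: continuous_cvg; first exact: sqrt_continuous.
exact: cvg_harmonic.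
Qed.

Let cvg_walk_moment_shift m (l : R) : walk_moment m n @[n --> \oo] --> l ->
  (walk n (fun x => x ^+ m) / Num.sqrt n.+1%:R ^+ m : R) @[n --> \oo] --> l.
Proof.
move=> hl; rewrite (_ : l = l * 1 ^+ m); last by rewrite expr1n mulr1.
have h : walk_moment m n * (Num.sqrt n%:R / Num.sqrt n.+1%:R) ^+ m @[n --> \oo]
    --> l * 1 ^+ m.
  by apply: cvgM => //; exact: cvg_exprn cvg_sqrt_ratio.
apply: (cvg_trans _ h); apply: near_eq_cvg; near=> n.
have n0 : Num.sqrt n%:R != 0 :> R.
  by rewrite gt_eqF// sqrtr_gt0 ltr0n; near: n; exact: nbhs_infty_gt.
by rewrite /walk_moment/= exprMn exprVn; field; rewrite !expf_neq0// gt_eqF// sqrtr_gt0.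
Unshelve. all: end_near. Qed.

Lemma nuSS m : nu m.+2 = (m.+1 * nu m)%N.
Proof.
rewrite /nu /= negbK; case: ifP => mo; first by rewrite muln0.
by case: m mo => [//|m] _.
Qed.

(** Strong induction on m: by Stein's identity the normalized moment of order
    m + 2 at time n + 1 is m + 1 times the one of order m at time n, plus lower
    moments multiplied by positive powers of 1 / sqrt (n + 1).  The limits satisfy
    the same recursion [nuSS]. *)
Theorem cvg_walk_moment m : walk_moment m n @[n --> \oo] --> ((nu m)%:R : R).
Proof.
elim/ltn_ind: m => -[|[|m]] IH.
- apply: cvg_near_cst; apply: nearW => n; rewrite /walk_moment expr0 divr1.
  under eq_walk do rewrite expr0 -[1](mulr1 1).
  by rewrite -(string_avg_steps n (fun=> 1 * 1)) string_avg_cst mulr1.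
- apply: cvg_near_cst; apply: nearW => -[|n]; rewrite /walk_moment.
    by rewrite /= expr1 mul0r.
  have -> : walk n.+1 (fun x => x ^+ 1) = walk n.+1 (fun x => x * (fun=> 1) x).
    by apply: eq_walk => x; rewrite mulr1 expr1.
  rewrite walk_stein (@eq_walk n _ (fun=> 0 * 0)).
    by rewrite walkZ !mul0r mulr0 mul0r.
  by move=> x; rewrite subrr !mul0r.
rewrite -(cvg_shiftS _).
have [c cE] := central_difference_expansion m.
have E n : walk_moment m.+2 n.+1 =
    m.+1%:R * (walk n (fun x => x ^+ m) / Num.sqrt n.+1%:R ^+ m) +
    \sum_(j < m) c j * (walk n (fun x => x ^+ j) / Num.sqrt n.+1%:R ^+ j)
       * (Num.sqrt n.+1%:R)^-1 ^+ (m - j).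
  rewrite /walk_moment; under eq_walk do rewrite exprS.
  rewrite (walk_stein n (fun x => x ^+ m.+1)).
  rewrite (eq_walk _ cE) walkD walkZ walk_sum.
  set s := Num.sqrt n.+1%:R.
  have s0 : s != 0 by rewrite gt_eqF// sqrtr_gt0.
  have -> : n.+1%:R = s ^+ 2 by rewrite sqr_sqrtr.
  have -> : s ^+ m.+2 = s ^+ 2 * s ^+ m by rewrite -exprD.
  rewrite mulrDr mulrDl; congr (_ + _).
    by field; rewrite s0 expf_neq0.
  rewrite mulr_sumr mulr_suml; apply: eq_bigr => j _; rewrite walkZ.
  have -> : s ^+ m = s ^+ j * s ^+ (m - j) by rewrite -exprD subnKC// ltnW.
  by rewrite exprVn; field; rewrite !expf_neq0.
rewrite (_ : (fun n => _) = (fun n => m.+1%:R * (walk n (fun x => x ^+ m) / Num.sqrt n.+1%:R ^+ m) +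
    \sum_(j < m) c j * (walk n (fun x => x ^+ j) / Num.sqrt n.+1%:R ^+ j)
       * (Num.sqrt n.+1%:R)^-1 ^+ (m - j))); last by apply/funext => n; exact: E.
have -> : (nu m.+2)%:R = m.+1%:R * (nu m)%:R + \sum_(j < m) 0 :> R.
  by rewrite nuSS natrM big1 ?addr0.
apply: cvgD.
  by apply: cvgM; [exact: cvg_cst|apply: cvg_walk_moment_shift; exact: IH].
apply: cvg_sum_ord => j.
rewrite (_ : 0 = c j * (nu j)%:R * 0 ^+ (m - j)); last first.
  by rewrite expr0n subn_eq0 leqNgt ltn_ord mulr0.
apply: cvgM; last exact: cvg_exprn cvg_inv_sqrt.
apply: cvgM; first exact: cvg_cst.
apply: cvg_walk_moment_shift; apply: IH.
by rewrite (ltn_trans (ltn_ord j)).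
Qed.
End walk.

(** * Fourth moments of sums over blocks *)
Section independent_sums.
Variable R : realType.

(** By independence the mean of each term of (s + z)^4 with odd exponents has the
    factor E s = 0 or E z = 0. *)
Lemma string_avg_independent_sum M N (f s z : seq bool -> R) :
  (forall x y, size x = M -> size y = N -> f (x ++ y) = s x + z y) ->
  string_avg M s = 0 -> string_avg N z = 0 ->
  [/\ string_avg (M + N) f = 0,
      string_avg (M + N) (fun x => f x ^+ 2) =
        string_avg M (fun x => s x ^+ 2) + string_avg N (fun y => z y ^+ 2)
    & string_avg (M + N) (fun x => f x ^+ 4) = string_avg M (fun x => s x ^+ 4) +
        6 * string_avg M (fun x => s x ^+ 2) * string_avg N (fun y => z y ^+ 2) +
        string_avg N (fun y => z y ^+ 4)].
Proof.
move=> fsz s0 z0; have E p : string_avg (M + N) (fun x => f x ^+ p) =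
    string_avg M (fun x => string_avg N (fun y => (s x + z y) ^+ p)).
  rewrite string_avg_cat; apply: eq_string_avg => x xM; apply: eq_string_avg => y yN.
  by rewrite fsz.
split.
- rewrite -[LHS]/(string_avg (M + N) (fun x => f x ^+ 1)) E.
  by under eq_string_avg do rewrite string_avgD string_avg_cst z0 addr0.
- rewrite E; transitivity (string_avg M (fun x => s x ^+ 2 + string_avg N (fun y => z y ^+ 2))).
    apply: eq_string_avg => x _.
    transitivity (string_avg N (fun y => s x ^+ 2 + ((2 * s x) * z y + z y ^+ 2))).
      by apply: eq_string_avg => y _; ring.
    by rewrite !string_avgD string_avgZ string_avg_cst z0 mulr0 add0r.
  by rewrite string_avgD string_avg_cst.
rewrite E; set a := string_avg N (fun y => z y ^+ 2); set b := string_avg N (fun y => z y ^+ 4).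
pose d := string_avg N (fun y => z y ^+ 3).
transitivity (string_avg M (fun x => s x ^+ 4 + ((6 * a) * s x ^+ 2 + ((4 * d) * s x + b)))).
  apply: eq_string_avg => x _.
  transitivity (string_avg N (fun y => s x ^+ 4 + ((4 * s x ^+ 3) * z y +
      ((6 * s x ^+ 2) * z y ^+ 2 + ((4 * s x) * z y ^+ 3 + z y ^+ 4))))).
    by apply: eq_string_avg => y _; ring.
  by rewrite !string_avgD !string_avgZ string_avg_cst z0 -/a -/b -/d; ring.
by rewrite !string_avgD !string_avgZ string_avg_cst s0; ring.
Qed.

(** The total length of the first k blocks. *)
Definition len k := (k * k.+1)./2.

Lemma lenS k : len k.+1 = (len k + k.+1)%N.
Proof.
rewrite /len (_ : k.+1 * k.+2 = k * k.+1 + k.+1.*2)%N; last by lia.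
by rewrite halfD odd_double andbF add0n doubleK.
Qed.

Lemma len_pred k : (k.+1 * k)./2 = len k.
Proof. by rewrite mulnC. Qed.

Lemma le_len m n : (m <= n)%N -> (len m <= len n)%N.
Proof. by move=> mn; apply/half_leq/leq_mul. Qed.

Lemma leq_len k : (k <= len k)%N.
Proof. by elim: k => [//|k IH]; rewrite lenS; lia. Qed.

(** The number of ones minus the number of zeros in block i. *)
Definition block_dev (w : nat -> bool) (i : nat) : R :=
  2 * (\sum_((i * i.-1)./2 <= j < (i * i.+1)./2) (w j)%:R) - i%:R.

Lemma block_dev_dep i w w' :
  (forall j, (j < len i)%N -> w j = w' j) -> block_dev w i = block_dev w' i.
Proof.
move=> ww'; congr (_ * _ - _); apply: eq_big_nat => j /andP[_ ji].
by rewrite ww'.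
Qed.

Lemma block_dev_cat x y k : size x = len k -> size y = k.+1 ->
  block_dev (nth false (x ++ y)) k.+1 = steps R y.
Proof.
move=> xk yk; rewrite /block_dev [(k.+1 * _)./2]len_pred.
rewrite (_ : (k.+1 * k.+2)./2 = len k + k.+1)%N; last first.
  by rewrite -lenS.
rewrite -[X in \sum_(X <= _ < _) _]add0n [(len k + _)%N]addnC big_addn addnK.
under eq_big_nat => j _ do rewrite nth_cat xk ltnNge leq_addl /= addnK.
rewrite -yk -(big_nth false xpredT (fun b : bool => b%:R)) mulr_sumr.
rewrite -sum1_size natr_sum -sumrB /steps.
by apply: eq_bigr => -[] _ /=; ring.
Qed.

Definition block_sum (g : nat -> R -> R) k (w : nat -> bool) : R :=
  \sum_(1 <= i < k.+1) g i (block_dev w i).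

Lemma block_sum_dep g k w w' :
  (forall j, (j < len k)%N -> w j = w' j) -> block_sum g k w = block_sum g k w'.
Proof.
move=> ww'; apply: eq_big_nat => i /andP[_ ik].
rewrite (@block_dev_dep i w w')// => j ji; apply: ww'.
exact: leq_trans ji (le_len _).
Qed.

Lemma block_sum_cat g k x y : size x = len k -> size y = k.+1 ->
  block_sum g k.+1 (nth false (x ++ y)) =
  block_sum g k (nth false x) + g k.+1 (steps R y).
Proof.
move=> xk yk; rewrite /block_sum big_nat_recr//= block_dev_cat//.
congr (_ + _); apply: block_sum_dep => j jk.
by rewrite nth_cat xk jk.
Qed.

(** Adding a block increases the second moment by at most B and the fourth by at
    most 6 (B k) B + B, whence the constant 3 B^2. *)
Lemma block_sum_moments g (B : R) : 1 <= B ->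
  (forall i, (0 < i)%N -> [/\ walk i (g i) = 0,
    walk i (fun x => g i x ^+ 2) <= B & walk i (fun x => g i x ^+ 4) <= B]) ->
  forall k, [/\ string_avg (len k) (fun x => block_sum g k (nth false x)) = 0,
    string_avg (len k) (fun x => block_sum g k (nth false x) ^+ 2) <= B * k%:R &
    string_avg (len k) (fun x => block_sum g k (nth false x) ^+ 4) <= 3 * B ^+ 2 * k%:R ^+ 2].
Proof.
move=> B1 gB; elim=> [|k [IH1 IH2 IH4]].
  by rewrite /= /block_sum big_geq//; split; rewrite ?expr0n ?mulr0.
have [g1 g2 g4] := gB k.+1 isT; rewrite lenS.
have [e1 e2 e4] := @string_avg_independent_sum (len k) k.+1
  (fun x => block_sum g k.+1 (nth false x)) (fun x => block_sum g k (nth false x))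
  (fun y => g k.+1 (steps R y)) (@block_sum_cat g k) IH1 (etrans (string_avg_steps _ _) g1).
rewrite (string_avg_steps k.+1 (fun x => g k.+1 x ^+ 2)) in e2 e4.
rewrite (string_avg_steps k.+1 (fun x => g k.+1 x ^+ 4)) in e4.
split => //; first by rewrite e2 -natr1 mulrDr mulr1 lerD.
have w0 : 0 <= walk k.+1 (fun x => g k.+1 x ^+ 2).
  by rewrite -string_avg_steps; apply: string_avg_ge0 => y; exact: sqr_ge0.
have s0 : 0 <= string_avg (len k) (fun x => block_sum g k (nth false x) ^+ 2).
  by apply: string_avg_ge0 => y; exact: sqr_ge0.
have k0 : 0 <= k%:R :> R by [].
rewrite e4 -natr1.
set a := walk _ _ in w0 g2 *; set b := walk _ _ in g4 *.
set d := string_avg _ _ in IH2 s0 *; set e := string_avg _ _ in IH4 *.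
set K := k%:R in IH2 IH4 k0 *.
have h : d * a <= B * K * B by apply: ler_pM.
have h' : B <= B ^+ 2 by rewrite expr2 ler_peMl// (le_trans ler01).
by nra.
Qed.

End independent_sums.

(** * Deciding deviations of moments by integer arithmetic *)
Section integer_test.
Local Open Scope nat_scope.

Definition isqrt n := \sum_(0 <= q < n) (q.+1 * q.+1 <= n).

Lemma isqrtP n : isqrt n * isqrt n <= n < (isqrt n).+1 * (isqrt n).+1.
Proof.
have [r /andP[r1 r2]] : exists r, r * r <= n < r.+1 * r.+1.
  elim: n => [|n [r /andP[r1 r2]]]; first by exists 0.
  have [nr|rn] := ltnP n.+1 (r.+1 * r.+1); first by exists r; rewrite nr (leqW r1).
  by exists r.+1; rewrite rn /=; nia.
suff -> : isqrt n = r by rewrite r1.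
rewrite /isqrt (big_cat_nat (n := r))//=; last by nia.
rewrite big_nat_cond (eq_bigr (fun=> 1)); last first.
  move=> q /andP[/andP[_ qr] _]; suff -> : q.+1 * q.+1 <= n by [].
  by apply: leq_trans r1; apply: leq_mul.
rewrite -big_nat_cond sum_nat_const_nat subn0 muln1 big_nat_cond big1 ?addn0//.
move=> q /andP[/andP[rq _] _]; apply/eqP; rewrite eqb0 -ltnNge.
by apply: leq_trans r2 _; apply: leq_mul.
Qed.

Variables (m c a : nat).

Definition iroot i := isqrt (i ^ m).

Lemma iroot_gt0 i : 0 < i -> 0 < iroot i.
Proof.
move=> i0; rewrite lt0n; apply/negP => /eqP r0; have := isqrtP (i ^ m).
by rewrite -/(iroot i) r0 => /andP[_]; rewrite ltnNge expn_gt0 i0.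
Qed.

(** The argument n stands for the sequence of its binary digits, and i for the
   number of a block.  Signed quantities are represented as differences of
   natural numbers, and denom k is a common denominator of the first k terms. *)
Let ones i n := \sum_(0 <= t < i) bit n (t + (i * i.-1) %/ 2).
Let dist i n := (2 * ones i n - i) + (i - 2 * ones i n).
Let pos i n := dist i n ^ m * (~~ odd m || (i <= 2 * ones i n)).
Let neg i n := dist i n ^ m * (odd m && ~~ (i <= 2 * ones i n)).
Let denom k := \prod_(0 <= i < k) iroot i.+1.
Let posum k n := \sum_(0 <= i < k) pos i.+1 n * (denom k %/ iroot i.+1).
Let negsum k n := \sum_(0 <= i < k) neg i.+1 n * (denom k %/ iroot i.+1) + a * (k * denom k).

(** The sum of the two truncated differences is the absolute value, so this
    compares with 1 / c the distance from a of an average of k terms;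
    see [integer_testE]. *)
Definition integer_test k n :=
  k * denom k < c * ((posum k n - negsum k n) + (negsum k n - posum k n)).

Lemma decidable_integer_test :
  decidable_pred (fun v : 2.-tuple nat => integer_test (thead v) (thead (tl v))).
Proof.
rewrite /integer_test /posum /negsum /pos /neg /denom /dist /ones /bit /iroot /isqrt.
by computability.
Qed.

Local Open Scope ring_scope.
Variable R : realType.

Definition moment_deviation k (w : nat -> bool) : R :=
  block_sum (fun i x => x ^+ m / (iroot i)%:R) k w - a%:R * k%:R.

Lemma natr_dist (p q : nat) : ((p - q) + (q - p))%:R = `|p%:R - q%:R| :> R.
Proof.
have [pq|qp] := leqP p q.
  rewrite (eqP pq) add0n natrB// ler0_norm ?subr_le0 ?ler_nat//.
  by rewrite opprB.
have {}qp := ltnW qp.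
by rewrite (eqP (qp : (q - p)%N == 0%N)) addn0 natrB// ger0_norm ?subr_ge0 ?ler_nat.
Qed.

(** Multiplying the real inequality by the common denominator of the weights
    turns both sides into natural numbers. *)
Lemma integer_testE k n :
  integer_test k n = (k%:R < c%:R * `|moment_deviation k (bit n)|).
Proof.
have dev_ones i : block_dev R (bit n) i.+1 = (2 * ones i.+1 n)%:R - i.+1%:R.
  rewrite /block_dev natrM; congr (_ * _ - _).
  rewrite -[X in \sum_(X <= _ < _) _]add0n big_addn /ones natr_sum divn2 len_pred.
  by rewrite -/(len i.+1) lenS addKn.
have pn i : (pos i.+1 n)%:R - (neg i.+1 n)%:R = block_dev R (bit n) i.+1 ^+ m.
  rewrite dev_ones /pos /neg /dist; move: (2 * ones i.+1 n)%N => q.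
  rewrite !natrM !natrX natr_dist; have [iq|qi] := leqP i.+1 q.
    by rewrite orbT andbF mulr1 mulr0 subr0 ger0_norm ?subr_ge0 ?ler_nat.
  rewrite orbF andbT ltr0_norm ?subr_lt0 ?ltr_nat//.
  rewrite exprNn -signr_odd; case: (odd m); rewrite /= ?mulr0 ?mulr1.
    by rewrite sub0r expr1 mulN1r opprK.
  by rewrite subr0 expr0 mul1r.
have d0 : (denom k)%:R > 0 :> R.
  by rewrite ltr0n; apply: prodn_gt0 => i; exact: iroot_gt0.
have quot i : (i < k)%N -> (denom k %/ iroot i.+1)%:R = (denom k)%:R / (iroot i.+1)%:R :> R.
  move=> ik; have r0 : (0 < iroot i.+1)%N by exact: iroot_gt0.
  apply: canRL (mulfK _) _; first by rewrite pnatr_eq0 -lt0n.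
  rewrite -natrM divnK// /denom big_mkord (bigD1 (Ordinal ik))//=.
  exact: dvdn_mulr.
have E : (posum k n)%:R - (negsum k n)%:R = (denom k)%:R * moment_deviation k (bit n) :> R.
  rewrite /posum /negsum natrD !natr_sum opprD addrA -sumrB mulrBr natrM.
  congr (_ - _); last by rewrite natrM; ring.
  rewrite /block_sum big_add1 /= mulr_sumr; apply: eq_big_nat => i /andP[_ ik].
  by rewrite (natrM _ (pos _ _)) (natrM _ (neg _ _)) -mulrBl pn quot//; ring.
rewrite /integer_test -(ltr_nat R) natrM natrM natr_dist E normrM gtr0_norm//.
by rewrite mulrCA mulrC ltr_pM2l.
Qed.

End integer_test.

(** * The strong law for the moments of a Schnorr random sequence *)
Lemma cvg_bounded_above (R : realType) (u : nat -> R) (l : R) :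
  u n @[n --> \oo] --> l -> exists B, forall n, u n <= B.
Proof.
move=> /cvgrPdist_le /(_ 1 ltr01) [N _ uN].
exists (\sum_(i < N) `|u i| + (`|l| + 1)) => n; have [nN|Nn] := ltnP n N.
  rewrite (bigD1 (Ordinal nN))//= -addrA (le_trans (ler_norm _))// lerDl.
  by rewrite addr_ge0 ?sumr_ge0// addr_ge0.
have := uN n Nn; rewrite ler_distl => /andP[+ _].
have := ler_norm l; have : 0 <= \sum_(i < N) `|u i| by rewrite sumr_ge0.
by rewrite /=; lra.
Qed.

Section strong_law.
Variables (R : realType) (m : nat).

Let Y i (x : R) := x ^+ m / (iroot m i)%:R.
Let mean i := walk i (Y i).

Lemma iroot_bounds i :
  (iroot m i)%:R <= (Num.sqrt i%:R : R) ^+ m < (iroot m i)%:R + 1.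
Proof.
have /andP[h1 h2] := isqrtP (i ^ m); rewrite -/(iroot m i) in h1 h2.
have s0 : 0 <= Num.sqrt i%:R ^+ m :> R by rewrite exprn_ge0// sqrtr_ge0.
have e : (Num.sqrt i%:R ^+ m) ^+ 2 = (i ^ m)%:R :> R.
  by rewrite -exprM mulnC exprM sqr_sqrtr// natrX.
rewrite -(@ler_pXn2r _ 2)// ?nnegrE// -(@ltr_pXn2r _ 2)// ?nnegrE ?addr_ge0//.
by rewrite e natr1 -!natrX ler_nat ltr_nat !expnS !expn0 !muln1 h1 h2.
Qed.

(** The integer part differs by less than 1 from sqrt n ^ m, which tends to
    infinity unless m = 0, and then both are 1. *)
Lemma cvg_root_ratio :
  (Num.sqrt n.+1%:R ^+ m / (iroot m n.+1)%:R : R) @[n --> \oo] --> (1 : R).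
Proof.
have s0 n : 0 < Num.sqrt n.+1%:R :> R by rewrite sqrtr_gt0.
have r0 n : 0 < (iroot m n.+1)%:R :> R by rewrite ltr0n iroot_gt0.
have h : ((iroot m n.+1)%:R / Num.sqrt n.+1%:R ^+ m : R) @[n --> \oo] --> (1 : R).
  have [->|m0] := posnP m.
    rewrite (_ : (fun n => _) = fun=> 1); first exact: cvg_cst.
    apply/funext => n; rewrite expr0 divr1 /iroot expn0.
    by rewrite /isqrt big_nat1.
  apply: (@squeeze_cvgr _ _ _ _ (fun n => 1 - (Num.sqrt n.+1%:R)^-1 ^+ m : R) (fun=> 1)).
  - apply: nearW => n; have /andP[h1 h2] := iroot_bounds n.+1.
    rewrite ler_pdivlMr ?exprn_gt0// ler_pdivrMr ?exprn_gt0// mul1r h1 andbT.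
    by rewrite mulrBl mul1r exprVn mulVf ?expf_neq0 ?gt_eqF// lerBlDr ltW.
  - have z : 1 - 0 ^+ m = 1 :> R by rewrite expr0n gtn_eqF// subr0.
    have : (1 - (Num.sqrt n.+1%:R)^-1 ^+ m : R) @[n --> \oo] --> (1 - 0 ^+ m : R).
      by apply: cvgB; [exact: cvg_cst|apply: cvg_exprn; exact: cvg_inv_sqrt].
    by rewrite z.
  - exact: cvg_cst.
rewrite (_ : (fun n => _) = fun n => ((iroot m n.+1)%:R / Num.sqrt n.+1%:R ^+ m)^-1); last first.
  by apply/funext => n; rewrite invf_div.
have : ((iroot m n.+1)%:R / Num.sqrt n.+1%:R ^+ m : R)^-1 @[n --> \oo] --> (1^-1 : R).
  by apply: cvgV; rewrite ?oner_eq0.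
by rewrite invr1.
Qed.

Let walk_weighted p n : walk n.+1 (fun x => Y n.+1 x ^+ p) =
  walk_moment R (m * p) n.+1 * (Num.sqrt n.+1%:R ^+ m / (iroot m n.+1)%:R) ^+ p.
Proof.
have s0 : Num.sqrt n.+1%:R != 0 :> R by rewrite gt_eqF// sqrtr_gt0.
have r0 : (iroot m n.+1)%:R != 0 :> R by rewrite pnatr_eq0 -lt0n iroot_gt0.
rewrite /walk_moment; transitivity (walk n.+1 (fun x => (iroot m n.+1)%:R ^- p * x ^+ (m * p) : R)).
  by apply: eq_walk => x; rewrite /Y exprMn exprVn exprM mulrC.
rewrite walkZ exprMn exprVn -exprM.
by field; rewrite !expf_neq0.
Qed.

Let cvg_weighted p : walk n.+1 (fun x => Y n.+1 x ^+ p) @[n --> \oo] --> ((nu (m * p))%:R : R).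
Proof.
under eq_fun do rewrite walk_weighted.
rewrite (_ : (nu (m * p))%:R = (nu (m * p))%:R * 1 ^+ p); last by rewrite expr1n mulr1.
apply: cvgM; last by apply: cvg_exprn; exact: cvg_root_ratio.
by rewrite (cvg_shiftS (walk_moment R (m * p))); exact: cvg_walk_moment.
Qed.

Lemma cvg_weighted_mean : walk n.+1 (fun x => x ^+ m / (iroot m n.+1)%:R) @[n --> \oo]
  --> ((nu m)%:R : R).
Proof. by have := @cvg_weighted 1%N; rewrite muln1. Qed.

Let centered i x := Y i x - mean i.

(** (a - b)^4 <= 8 a^4 + 8 b^4 reduces the bound to the convergence of the
    moments of order 4 m and of the means; the second moment is bounded by the
    fourth plus 1. *)
Let centered_bound : exists B : R, 1 <= B /\ forall i, (0 < i)%N ->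
  [/\ walk i (centered i) = 0, walk i (fun x => centered i x ^+ 2) <= B
    & walk i (fun x => centered i x ^+ 4) <= B].
Proof.
have mono i g h : (forall x : R, g x <= h x) -> walk i g <= walk i h.
  by move=> gh; rewrite -!string_avg_steps; apply: le_string_avg => y; exact: gh.
have cst i (e : R) : walk i (fun=> e) = e by rewrite -(string_avg_steps i (fun=> e)) string_avg_cst.
have : (8 * walk n.+1 (fun x => Y n.+1 x ^+ 4) + 8 * mean n.+1 ^+ 4 : R) @[n --> \oo] -->
    (8 * (nu (m * 4))%:R + 8 * (nu m)%:R ^+ 4 : R).
  apply: cvgD; first by apply: cvgM; [exact: cvg_cst|exact: cvg_weighted].
  by apply: cvgM; [exact: cvg_cst|apply: cvg_exprn; exact: cvg_weighted_mean].
move=> /cvg_bounded_above[B0 B0P]; exists (`|B0| + 1); split; first by rewrite lerDr.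
move=> [//|n] _; have h4 : walk n.+1 (fun x => centered n.+1 x ^+ 4) <= `|B0|.
  apply: le_trans (ler_norm B0); apply: le_trans (B0P n).
  rewrite -[8 * mean _ ^+ 4](cst n.+1) -walkZ -walkD; apply: mono => x.
  rewrite /centered; move: (Y _ _) (mean _) => a b.
  have : 0 <= (a ^+ 2 - b ^+ 2) ^+ 2 by exact: sqr_ge0.
  have : 0 <= (a + b) ^+ 2 * (a - b) ^+ 2 by rewrite mulr_ge0 ?sqr_ge0.
  have : 0 <= ((a + b) ^+ 2) ^+ 2 by exact: sqr_ge0.
  by lra.
split; last by rewrite (le_trans h4)// lerDl.
  rewrite /centered walkD (cst n.+1 (- mean n.+1)).
  by rewrite subrr.
apply: le_trans (lerD h4 (lexx 1)).
rewrite -[X in _ <= _ + X](cst n.+1) -walkD; apply: mono => x.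
move: (centered _ _) => a; have : 0 <= (a ^+ 2 - 2^-1) ^+ 2 by exact: sqr_ge0.
by lra.
Qed.

Let cvg_mean_sum : (\sum_(1 <= i < k.+1) mean i) / k%:R @[k --> \oo] --> ((nu m)%:R : R).
Proof.
rewrite -(cvg_shiftS _) /=; have := cesaro cvg_weighted_mean.
apply: cvg_trans; apply: near_eq_cvg; apply: nearW => n /=.
by rewrite /arithmetic_mean /series /= mulrC big_add1.
Qed.

(** Markov's inequality for the fourth power.  The means themselves converge to
    nu m, so for large k half of the allowed deviation absorbs the distance of
    their average from nu m. *)
Let deviation_bound (c : nat) : exists C k0 : nat, forall k, (k0 <= k)%N -> (0 < k)%N ->
  string_avg (len k) (fun x => (k%:R < c%:R * `|moment_deviation m (nu m) R k (nth false x)| :> R)%:R)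
    <= C%:R / (k%:R * k.+1%:R) :> R.
Proof.
have [B [B1 BP]] := centered_bound.
have e0 : 0 < (2 * c.+1%:R)^-1 :> R by rewrite invr_gt0 mulr_gt0.
have /cvgrPdist_le/(_ _ e0)[k0 _ k0P] := cvg_mean_sum.
pose A : R := 6 * B ^+ 2 * (2 * c%:R) ^+ 4.
have [C AC] : exists C : nat, A <= C%:R.
  by exists (Num.truncn `|A|).+1; rewrite ltW// (le_lt_trans (ler_norm A))// truncnS_gt.
exists C, k0 => k k0k k_gt0; have k0' : 0 < k%:R :> R by rewrite ltr0n.
have [_ _ S4] := block_sum_moments B1 BP k.
set S := fun x => block_sum centered k (nth false x) in S4 *.
have devE x : moment_deviation m (nu m) R k (nth false x) =
    S x + (\sum_(1 <= i < k.+1) mean i - (nu m)%:R * k%:R).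
  by rewrite /S /moment_deviation /block_sum sumrB /Y; ring.
have drift : `|\sum_(1 <= i < k.+1) mean i - (nu m)%:R * k%:R| <= k%:R / (2 * c.+1%:R).
  have := k0P k k0k; rewrite /= distrC => h.
  rewrite -(ler_pM2r (_ : 0 < k%:R^-1 :> R)) ?invr_gt0//.
  rewrite -[X in _ * X](@ger0_norm _ k%:R^-1) ?invr_ge0// -normrM mulrBl mulfK ?gt_eqF//.
  by rewrite mulrAC divff ?gt_eqF// mul1r.
apply: (@le_trans _ _ (string_avg (len k) (fun x => ((2 * c%:R) ^+ 4 / k%:R ^+ 4) * S x ^+ 4))).
  apply: le_string_avg => x; case: (boolP (k%:R < _)) => [|_] /=; last first.
    by apply: mulr_ge0; [rewrite divr_ge0 ?exprn_ge0 ?mulr_ge0|exact: exprn_even_ge0].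
  rewrite devE => h.
  have h1 : k%:R / 2 <= c%:R * `|S x|.
    have h2 : c%:R * `|\sum_(1 <= i < k.+1) mean i - (nu m)%:R * k%:R| <= k%:R / 2.
      apply: (@le_trans _ _ (c%:R * (k%:R / (2 * c.+1%:R)))); first by rewrite ler_wpM2l.
      rewrite mulrA ler_pdivrMr ?mulr_gt0// -(natr1 c).
      by move: k0' (ler0n R c); move: (k%:R) (c%:R) => p q p0 q0; lra.
    have := ler_wpM2l (ler0n R c) (ler_normD (S x) (\sum_(1 <= i < k.+1) mean i - (nu m)%:R * k%:R)).
    by rewrite mulrDr; lra.
  have h2 : 1 <= (2 * c%:R * `|S x| / k%:R) ^+ 4.
    by rewrite exprn_ege1// ler_pdivlMr// mul1r; lra.
  apply: le_trans h2 _; rewrite !exprMn exprVn -normrX (ger0_norm (_ : 0 <= S x ^+ 4)).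
    by rewrite mulrAC.
  by rewrite exprn_even_ge0.
rewrite string_avgZ.
apply: (@le_trans _ _ (((2 * c%:R) ^+ 4 / k%:R ^+ 4) * (3 * B ^+ 2 * k%:R ^+ 2))).
  by rewrite ler_wpM2l ?divr_ge0 ?exprn_ge0.
apply: (@le_trans _ _ (A / (k%:R * k.+1%:R))); last first.
  by rewrite ler_wpM2r ?invr_ge0 ?mulr_ge0.
have k1 : 1 <= k%:R :> R by rewrite ler1n.
rewrite -subr_ge0 -(natr1 k) /A; move: k0' k1 (ler0n R c); move: (k%:R) (c%:R) => p q p0 p1 q0.
have B0 : 0 <= B by rewrite (le_trans ler01).
rewrite (_ : _ - _ = 3 * B ^+ 2 * (2 * q) ^+ 4 * (p - 1) / (p ^+ 2 * (p + 1))); last first.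
  by field; rewrite !gt_eqF ?addr_gt0.
by rewrite divr_ge0 ?mulr_ge0 ?sqr_ge0 ?subr_ge0 ?addr_ge0 // ?ltW.
Qed.

(** The effective Borel-Cantelli lemma applied to the events of the preceding
    bound, which the integer test decides. *)
Lemma eventually_moment_deviation (omega : nat -> bool) (c : nat) : schnorr_random R omega ->
  exists K, forall k, (K <= k)%N ->
    c%:R * `|moment_deviation m (nu m) R k omega| <= k%:R :> R.
Proof.
move=> rnd; pose T k (w : nat -> bool) : bool :=
  k%:R < c%:R * `|moment_deviation m (nu m) R k w| :> R.
have [C [k0 Ck0]] := deviation_bound c.
have Tdep k : depends_on (len k) (T k).
  by move=> w w' ww'; rewrite /T /moment_deviation (block_sum_dep _ ww').
have clen : computable (fun v : 1.-tuple nat => len (thead v)).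
  rewrite /len; apply: (computable_ext (F := fun v => (thead v * (thead v).+1) %/ 2)%N).
    by move=> v; rewrite divn2.
  by computability.
have dT : decidable_pred (fun v : 2.-tuple nat => T (thead v) (bit (thead (tl v)))).
  apply: computable_ext (decidable_integer_test m c (nu m)) => v.
  by rewrite (integer_testE _ _ _ R).
have [K KP] := schnorr_borel_cantelli leq_len le_len Tdep clen dT Ck0 rnd.
by exists K => k Kk; rewrite leNgt; exact: KP.
Qed.

End strong_law.

Section empirical_moments.
Variables (R : realType) (omega : nat -> bool).
Hypothesis random : schnorr_random R omega.

Let X := normalized_block_sum R omega.
Let weighted m i (x : R) := x ^+ m / (iroot m i)%:R.

Lemma cvg_weighted_average m :
  block_sum (weighted m) k omega / k%:R @[k --> \oo] --> ((nu m)%:R : R).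
Proof.
apply/cvgrPdist_le => e e0.
pose c := (Num.truncn e^-1).+1.
have ce : c%:R^-1 <= e :> R.
  by rewrite -[e]invrK lef_pV2 ?posrE ?invr_gt0 ?ltr0n// ltW// truncnS_gt.
have [K KP] := eventually_moment_deviation m c random.
near=> k; have k0 : 0 < k%:R :> R by rewrite ltr0n; near: k; exact: nbhs_infty_gt.
have Kk : (K <= k)%N by near: k; exact: nbhs_infty_ge.
apply: le_trans ce; have := KP k Kk; rewrite /moment_deviation -/(weighted m) => h.
rewrite distrC -(ler_pM2r k0) -[X in _ * X]gtr0_norm// -normrM mulrBl divfK ?gt_eqF//.
by rewrite ler_pdivlMl ?ltr0n.
Unshelve. all: end_near. Qed.

(** The finitely many indices with large e disappear in the average, and the
    others contribute at most the supremum of the remaining values of e times the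
    average of u. *)
Lemma cvg_average_null (u e : nat -> R) (B : R) :
  (forall i, 0 <= u i) -> (forall k, (\sum_(1 <= i < k.+1) u i) / k%:R <= B) ->
  e n @[n --> \oo] --> (0 : R) ->
  (\sum_(1 <= i < k.+1) u i * e i) / k%:R @[k --> \oo] --> (0 : R).
Proof.
move=> u0 uB e0; apply/cvgr0Pnorm_le => eps eps0.
have B0 : 0 <= B by have := uB 0%N; rewrite big_geq// mul0r.
pose d := eps / 2 / (B + 1).
have d0 : 0 < d by rewrite !divr_gt0// ltr_wpDl.
have /cvgr0Pnorm_le/(_ _ d0)[N _ eN] := e0.
pose A := \sum_(1 <= i < N.+1) u i * `|e i|.
have A0 : 0 <= A by rewrite sumr_ge0// => i _; rewrite mulr_ge0.
near=> k; have k0 : 0 < k%:R :> R by rewrite ltr0n; near: k; exact: nbhs_infty_gt.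
have Nk : (N < k)%N by near: k; exact: nbhs_infty_gt.
have Ak : A <= eps / 2 * k%:R.
  rewrite -ler_pdivrMl ?divr_gt0//; near: k.
  exists (Num.truncn ((eps / 2)^-1 * A)).+1 => //= k Nk.
  by apply: (le_trans (ltW (truncnS_gt _))); rewrite ler_nat.
rewrite normrM [`|_^-1|]gtr0_norm ?invr_gt0// ler_pdivrMr//.
apply: le_trans (ler_norm_sum _ _ _) _.
under eq_bigr do rewrite normrM (ger0_norm (u0 _)).
rewrite (big_cat_nat (n := N.+1))//=; last by rewrite ltnS ltnW.
have tail : \sum_(N.+1 <= i < k.+1) u i * `|e i| <= d * (B * k%:R).
  apply: (@le_trans _ _ (d * \sum_(1 <= i < k.+1) u i)); last first.
    by rewrite ler_pM2l// -ler_pdivrMr.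
  rewrite [X in d * X](big_cat_nat (n := N.+1))//=; last by rewrite ltnS ltnW.
  rewrite mulrDr [X in _ <= _ + X]mulr_sumr -[X in X <= _]add0r lerD//.
    by rewrite mulr_ge0 ?sumr_ge0// ltW.
  apply: ler_sum_nat => i /andP[Ni _]; rewrite mulrC ler_wpM2r//.
  by apply: eN; exact: ltnW.
have dB : d * (B * k%:R) <= eps / 2 * k%:R.
  rewrite mulrA ler_pM2r// /d mulrAC ler_pdivrMr ?ltr_wpDl//.
  by rewrite ler_pM2l ?divr_gt0// lerDl.
by move: (lerD Ak (le_trans tail dB)); rewrite -/A -mulrDl -splitr.
Unshelve. all: end_near. Qed.

Let X_dev m i : X i ^+ m = block_dev R omega i ^+ m / Num.sqrt i%:R ^+ m.
Proof. by rewrite /X /normalized_block_sum exprMn exprVn mulrC. Qed.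

(** The integer part is at most sqrt i ^ (2 m), so dividing by it instead can only
    increase an even power: the averages of X^(2 m) are bounded by a convergent
    sequence. *)
Let average_bound m : exists B : R, forall k,
  (\sum_(1 <= i < k.+1) (1 + X i ^+ (2 * m))) / k%:R <= B.
Proof.
have [B BP] := cvg_bounded_above (@cvg_weighted_average (2 * m)%N).
exists (1 + B) => k; have [->|k_gt0] := posnP k.
  by rewrite big_geq// mul0r; have := BP 0%N; rewrite /block_sum big_geq// mul0r; lra.
have k0 : 0 < k%:R :> R by rewrite ltr0n.
rewrite big_split/= sumr_const_nat subSS subn0 mulrDl divff ?gt_eqF// lerD2l.
apply: le_trans (BP k); rewrite ler_pM2r ?invr_gt0//.
apply: ler_sum_nat => i /andP[i0 _]; rewrite X_dev /weighted.
have /andP[h _] := iroot_bounds R (2 * m) i.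
rewrite ler_wpM2l ?exprn_even_ge0 ?oddM// lef_pV2// posrE ?ltr0n ?iroot_gt0//.
by rewrite exprn_gt0// sqrtr_gt0 ltr0n.
Qed.

(** X_i^m and its weighted version differ by X_i^m (1 - ratio i).  The bound
    |y| <= 1 + y^2 writes this as a quantity u i = 1 + X_i^(2 m) with bounded
    averages times a null sequence e i. *)
Theorem cvg_empirical_moment m :
  empirical_moment X m k @[k --> \oo] --> ((nu m)%:R : R).
Proof.
have [B BP] := average_bound m.
pose ratio i : R := Num.sqrt i%:R ^+ m / (iroot m i)%:R.
pose u i := 1 + X i ^+ (2 * m).
pose e i := X i ^+ m / u i * (1 - ratio i).
have even0 i : 0 <= X i ^+ (2 * m) by rewrite exprn_even_ge0// oddM.
have u0 i : 0 < u i by rewrite ltr_pwDl.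
have e0 : e n @[n --> \oo] --> (0 : R).
  rewrite -(cvg_shiftS _) /=.
  have r0 : `|1 - ratio n.+1| @[n --> \oo] --> (0 : R).
    rewrite -(@normr0 _ R); apply: cvg_norm.
    have : (1 - ratio n.+1 : R) @[n --> \oo] --> (1 - 1 : R).
      by apply: cvgB; [exact: cvg_cst|exact: cvg_root_ratio].
    by rewrite subrr.
  apply: norm_cvg0; apply: (squeeze_cvgr _ (cvg_cst 0) r0).
  apply: nearW => n; rewrite normr_ge0 /= normrM ler_piMl// normrM.
  rewrite [`|_^-1|]gtr0_norm ?invr_gt0// ler_pdivrMr// mul1r /u mulnC exprM.
  rewrite -[X in _ <= _ + X]real_normK ?num_real//.
  by have := sqr_ge0 (`|X n.+1 ^+ m| - 2^-1); lra.
have h := cvg_average_null (fun i => ltW (u0 i)) BP e0.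
have : empirical_moment X m k - block_sum (weighted m) k omega / k%:R @[k --> \oo] --> (0 : R).
  apply: cvg_trans h; apply: near_eq_cvg; apply: nearW => k.
  rewrite /empirical_moment /block_sum -mulrBl -sumrB; congr (_ / _).
  apply: eq_big_nat => i /andP[i0 _]; rewrite /e mulrA mulrCA divff ?gt_eqF// mulr1.
  rewrite mulrBr mulr1 /ratio /weighted X_dev; congr (_ - _).
  by rewrite mulrA divfK// expf_neq0// gt_eqF// sqrtr_gt0 ltr0n.
move=> /cvgD /(_ (@cvg_weighted_average m)); rewrite add0r; apply: cvg_trans.
by apply: near_eq_cvg; apply: nearW => k /=; rewrite subrK.
Qed.

End empirical_moments.

(** * Integrals with respect to the empirical law *)
Section empirical_law.
Variables (R : realType) (X : nat -> R) (k : nat).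

Let ge0_integral_empirical_law (g : R -> \bar R) :
  measurable_fun setT g -> (forall x, (0 <= g x)%E) ->
  (\int[empirical_law X k]_x g x = (k%:R^-1)%:E * \sum_(n < k) g (X n.+1))%E.
Proof.
move=> mg g0; rewrite /empirical_law ge0_integral_mscale//.
congr (_ * _)%E; rewrite ge0_integral_measure_sum//; apply: eq_bigr => n _.
by rewrite integral_dirac// diracT mul1e.
Qed.

Lemma integral_empirical_law (h : R -> R) : measurable_fun setT h ->
  (\int[empirical_law X k]_x (h x)%:E =
   ((\sum_(1 <= i < k.+1) h (X i)) / k%:R)%:E)%E.
Proof.
move=> mh; have mh' : measurable_fun setT (EFin \o h) by exact/measurable_EFinP.
rewrite integralE !ge0_integral_empirical_law//; first last.
- exact: measurable_funepos.
- exact: measurable_funeneg.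
rewrite funerpos funerneg !sumEFin -!EFinM -EFinB; congr EFin.
rewrite -mulrBr mulrC -sumrB big_add1 /= big_mkord; congr (_ / _).
by apply: eq_bigr => i _; rewrite -[in RHS](funrposBneg h).
Qed.

End empirical_law.

(** * Moments of the standard normal distribution *)
Section gauss.
Variable R : realType.
Local Notation mu := (@lebesgue_measure R).
Local Notation phi := (@normal_pdf R 0 1).
Local Notation gauss := (@normal_prob R 0 1).

Lemma measurable_phi : measurable_fun setT phi.
Proof. exact: measurable_normal_pdf. Qed.

Let phi_ge0 x : 0 <= phi x. Proof. exact: normal_pdf_ge0. Qed.

(** The change of variables available for measures with a density is stated for
    the Radon-Nikodym derivative, which is the normal density almost
    everywhere. *)
Let density_ae : ae_eq mu setT (Radon_Nikodym_SigmaFinite.f gauss mu) (EFin \o phi).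
Proof.
have dom : gauss `<< mu by exact: normal_prob_dominates.
apply: integral_ae_eq => //.
- exact: Radon_Nikodym_SigmaFinite.f_integrable.
- by apply/measurable_EFinP; exact: measurable_phi.
- move=> A _ mA; rewrite -Radon_Nikodym_SigmaFinite.f_integral//.
Qed.

Let ge0_integral_gauss (g : R -> \bar R) : measurable_fun setT g ->
  (forall x, (0 <= g x)%E) ->
  (\int[gauss]_x g x = \int[mu]_x (g x * (phi x)%:E))%E.
Proof.
move=> mg g0; have dom : gauss `<< mu by exact: normal_prob_dominates.
rewrite -(Radon_Nikodym_SigmaFinite.change_of_variables dom g0 measurableT mg).
apply: ae_eq_integral => //.
- apply: emeasurable_funM => //.
  exact: measurable_int (Radon_Nikodym_SigmaFinite.f_integrable dom).
- apply: emeasurable_funM => //; apply/measurable_EFinP; exact: measurable_phi.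
- exact: ae_eqe_mul2l density_ae.
Qed.

(** The density is nonnegative, so multiplying by it commutes with taking
    positive and negative parts. *)
Lemma integral_gauss (h : R -> R) : measurable_fun setT h ->
  (\int[gauss]_x (h x)%:E = \int[mu]_x (h x * phi x)%:E)%E.
Proof.
move=> mh; have mh' : measurable_fun setT (EFin \o h) by exact/measurable_EFinP.
rewrite integralE [RHS]integralE !ge0_integral_gauss//; first last.
- exact: measurable_funepos.
- exact: measurable_funeneg.
congr (_ - _)%E; apply: eq_integral => x _;
  rewrite ?funerpos ?funerneg /= -EFinM.
- by rewrite /funrpos maxr_pMl// mul0r.
- by rewrite /funrneg maxr_pMl// mul0r mulNr.
Qed.

(** Domination by the normal density of standard deviation 2: in
    exp (- x^2 / 2) = exp (- x^2 / 8) exp (- z) with z = 3 x^2 / 8, the last factor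
    absorbs all powers of x. *)
Lemma power_phi_bound m : exists2 C : R, 0 <= C &
  forall x, `|x| ^+ m * phi x <= C * normal_pdf 0 2 x.
Proof.
have p2 : 0 < normal_peak 2 :> R by rewrite normal_peak_gt0.
pose D : R := 1 + (8 / 3) ^+ m.+1 * m.+1`!%:R.
have D0 : 0 <= D by rewrite addr_ge0// mulr_ge0// exprn_ge0.
exists (normal_peak 1 / normal_peak 2 * D) => [|x].
  by rewrite mulr_ge0// divr_ge0// normal_peak_ge0.
rewrite !normal_pdfE ?oner_eq0// /normal_fun !subr0 expr1n.
pose z : R := 3 / 8 * x ^+ 2.
have z0 : 0 <= z by rewrite mulr_ge0 ?sqr_ge0.
have -> : - x ^+ 2 / (1 *+ 2) = - x ^+ 2 / (2 ^+ 2 *+ 2) - z by rewrite /z; field.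
rewrite expRD expRN; set E := expR (_ / _).
have ez : 0 < expR z by exact: expR_gt0.
have key : `|x| ^+ m <= D * expR z.
  apply: (@le_trans _ _ (1 + (x ^+ 2) ^+ m.+1)).
    have [x1|x1] := leP `|x| 1.
      by rewrite (@le_trans _ _ 1) ?exprn_ile1// lerDl exprn_ge0// sqr_ge0.
    rewrite -real_normK ?num_real// -exprM.
    apply: (@le_trans _ _ (`|x| ^+ (2 * m.+1))); last by rewrite lerDr.
    by rewrite ler_weXn2l// ?ltW//; lia.
  have e1 : 1 <= expR z by rewrite -[X in X <= _]expR0 ler_expR.
  have xz : x ^+ 2 = 8 / 3 * z by rewrite /z; field.
  rewrite mulrDl mul1r lerD// xz exprMn -mulrA ler_wpM2l ?exprn_ge0//.
  have := expR_ge1Dxn m z0; rewrite -ler_pdivrMl ?ltr0n ?fact_gt0// mulrC => h.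
  by apply: le_trans h; rewrite lerDr.
apply: (@le_trans _ _ (D * expR z * (normal_peak 1 * (E * (expR z)^-1)))).
  by rewrite ler_wpM2r// mulr_ge0 ?normal_peak_ge0// divr_ge0 ?expR_ge0.
by rewrite le_eqVlt; apply/orP; left; apply/eqP; field; rewrite !gt_eqF.
Qed.

Lemma integrable_power_phi m : mu.-integrable setT (fun x => (x ^+ m * phi x)%:E).
Proof.
have [C C0 CP] := power_phi_bound m.
apply: (@le_integrable _ _ _ mu _ measurableT _ (fun x => C%:E * (normal_pdf 0 2 x)%:E)%E) => //.
- apply/measurable_EFinP; apply: measurable_funM; last exact: measurable_phi.
  exact: exprn_measurable.
- move=> x _ /=; rewrite lee_fin normrM normrX.
  rewrite (ger0_norm (phi_ge0 x)) (le_trans (CP x))// ler_norm.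
  by [].
- by apply: integrableZl => //; exact: integrable_normal_pdf.
Qed.

Let phiE x : phi x = normal_peak 1 * expR (- 2^-1 * x ^+ 2).
Proof.
rewrite normal_pdfE ?oner_eq0// /normal_fun subr0 expr1n.
by congr (_ * expR _); rewrite mulrC mulrN mulNr.
Qed.

Let is_derive_power_phi m (x : R) :
  is_derive x 1 (fun y => y ^+ m * phi y) ((m%:R * x ^+ m.-1 - x ^+ m.+1) * phi x).
Proof.
have hsq : is_derive x (1 : R) (fun y => - (2^-1) *: (@id R ^+ 2) y)
    (- (2^-1) *: ((2%:R * x ^+ 1) *: (1 : R))).
  by apply: is_deriveZ; apply: is_deriveX.
have hc := is_deriveZ (normal_peak 1) (is_derive1_comp (is_derive_expR _) hsq).
have hm : is_derive x (1 : R) (@id R ^+ m) ((m%:R * x ^+ m.-1) *: (1 : R)).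
  by apply: is_deriveX.
have hM := is_deriveM hm hc.
have -> : (fun y => y ^+ m * phi y) = (id ^+ m) * (normal_peak 1 \*:
    (expR \o (fun y : R => - (2^-1) *: (@id R ^+ 2) y))).
  by apply/funext => y; rewrite phiE mulrfctE /GRing.scale /= !exprfctE.
apply: is_derive_eq hM _.
rewrite phiE /GRing.scale /= /GRing.scale /= !exprfctE [in RHS](exprS x m) /=.
by field.
Qed.

Let continuous_phi : continuous phi.
Proof. by apply: continuous_normal_pdf; exact: oner_neq0. Qed.

Let ftc_phi m (a : R) : 0 < a ->
  (\int[mu]_(x in `[(- a)%R, a]) ((m%:R * x ^+ m.-1 - x ^+ m.+1) * phi x)%:E =
   (a ^+ m * phi a)%:E - ((- a) ^+ m * phi (- a))%:E)%E.
Proof.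
move=> a0; have cX j : continuous (fun x : R => x ^+ j) by exact: exprn_continuous.
rewrite (@continuous_FTC2 _ _ (fun y => y ^+ m * phi y))//.
- by rewrite gtrN.
- apply: continuous_subspaceT => x; apply: cvgM; last exact: continuous_phi.
  apply: cvgB; last exact: cX.
  by apply: cvgM; [exact: cvg_cst|exact: cX].
- have cF : continuous (fun y : R => y ^+ m * phi y).
    by move=> x; apply: cvgM; [exact: cX|exact: continuous_phi].
  split => [x _| |].
  + exact: (@ex_derive _ _ _ _ _ _ _ (is_derive_power_phi m x)).
  + by apply: cvg_at_right_filter; exact: cF.
  + by apply: cvg_at_left_filter; exact: cF.
- move=> x _; rewrite derive1E.
  by rewrite (@derive_val _ _ _ _ _ _ _ (is_derive_power_phi m x)).
Qed.

Let integrable_poly_phi m :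
  mu.-integrable setT (fun x => ((m%:R * x ^+ m.-1 - x ^+ m.+1) * phi x)%:E).
Proof.
have -> : (fun x : R => ((m%:R * x ^+ m.-1 - x ^+ m.+1) * phi x)%:E) =
    ((fun x => m%:R%:E * (x ^+ m.-1 * phi x)%:E) \- (fun x => (x ^+ m.+1 * phi x)%:E))%E.
  by apply/funext => x /=; rewrite -EFinM -EFinB; congr EFin; ring.
apply: integrableB => //; last exact: integrable_power_phi.
by apply: integrableZl => //; exact: integrable_power_phi.
Qed.

(** The integrand is the derivative of x^m phi(x), so its integral over [-n, n]
    is a boundary term; this is O(1 / n) because x^(m+1) phi(x) is bounded. *)
Let integral_poly_phi m :
  (\int[mu]_x ((m%:R * x ^+ m.-1 - x ^+ m.+1) * phi x)%:E = 0)%E.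
Proof.
set f := (fun x : R => (_ * phi x)%:E).
have mf : measurable_fun setT f by exact: measurable_int (integrable_poly_phi m).
pose I n : set R := `[(- n%:R)%R, n%:R]%classic.
have mI n : measurable (I n) by exact: measurable_itv.
have mfI n : measurable_fun setT (f \_ (I n)).
  by apply/(measurable_restrictT _ (mI n)); exact: measurable_funTS.
have fI x : (f \_ (I n)) x @[n --> \oo] --> f x.
  apply: cvg_near_cst; near=> n; rewrite patchE mem_set// /I /= in_itv /= -ler_norml.
  apply: ltW; apply: lt_le_trans (truncnS_gt _) _; rewrite ler_nat.
  by near: n; exact: nbhs_infty_ge.
have fb x n : (`|(f \_ (I n)) x| <= `|f x|)%E.
  by rewrite patchE; case: ifP => // _; rewrite abse0 abse_ge0.
have h : (\int[mu]_x (f \_ (I n)) x @[n --> \oo] --> \int[mu]_x f x)%E.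
  have ig : mu.-integrable setT (fun x => `|f x|)%E.
    exact: integrable_abse (integrable_poly_phi m).
  have [] // := @dominated_convergence _ _ _ mu _ measurableT (fun n => f \_ (I n))
    f (fun x => `|f x|)%E mfI mf _ ig.
  - by apply: aeW => x _; exact: fI.
  - by apply: aeW => x n _; exact: fb.
have [C C0 CP] := power_phi_bound m.+1.
pose B := C * normal_peak 2.
have B0 : 0 <= B by rewrite mulr_ge0 ?normal_peak_ge0.
have small (a : R) : a != 0 -> `|a ^+ m * phi a| <= B / `|a|.
  move=> a0; rewrite ler_pdivlMr ?normr_gt0// normrM normrX (ger0_norm (phi_ge0 a)).
  rewrite mulrAC -exprSr (le_trans (CP a))// ler_wpM2l// normal_pdf_ub//.
have h0 : ((\int[mu]_x (f \_ (I n)) x) @[n --> \oo] --> 0)%E.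
  rewrite -(cvg_shiftS _) /=.
  have E n : (\int[mu]_x (f \_ (I n.+1)) x = (n.+1%:R ^+ m * phi n.+1%:R -
      (- n.+1%:R) ^+ m * phi (- n.+1%:R))%:E)%E.
    by rewrite -integral_mkcond ftc_phi// EFinB.
  under eq_fun do rewrite E.
  apply: cvg_EFin; first by apply: nearW.
  apply: norm_cvg0; apply: (@squeeze_cvgr _ _ _ _ (cst 0) (fun n => 2 * B * n.+1%:R^-1)).
  - apply: nearW => n; rewrite normr_ge0 /= (le_trans (ler_normB _ _))//.
    have n0 : n.+1%:R != 0 :> R by [].
    have n1 : - n.+1%:R != 0 :> R by rewrite oppr_eq0.
    apply: le_trans (lerD (small _ n0) (small _ n1)) _.
    by rewrite [X in _ / X + _]ger0_norm// normrN ger0_norm// -mulrA mulr_natl mulr2n.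
  - exact: cvg_cst.
  - by rewrite -(mulr0 (2 * B)); apply: cvgM; [exact: cvg_cst|exact: cvg_harmonic].
exact: (cvg_unique _ h h0).
Unshelve. all: end_near. Qed.

Let integral_power_phi_rec m :
  (\int[mu]_x (x ^+ m.+1 * phi x)%:E = m%:R%:E * \int[mu]_x (x ^+ m.-1 * phi x)%:E)%E.
Proof.
have fin k : (\int[mu]_x (x ^+ k * phi x)%:E \is a fin_num)%E.
  by apply: integrable_fin_num => //; exact: integrable_power_phi.
have := integral_poly_phi m.
have -> : (fun x : R => ((m%:R * x ^+ m.-1 - x ^+ m.+1) * phi x)%:E) =
    ((fun x => m%:R%:E * (x ^+ m.-1 * phi x)%:E) \- (fun x => (x ^+ m.+1 * phi x)%:E))%E.
  by apply/funext => x /=; rewrite -EFinM -EFinB; congr EFin; ring.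
have im := integrable_power_phi m.-1; have im' := integrable_power_phi m.+1.
rewrite integralB//=; last exact: integrableZl.
rewrite integralZl//= -(fineK (fin m.-1)) -(fineK (fin m.+1)) -EFinM -EFinB => -[/eqP].
by rewrite subr_eq0 => /eqP <-.
Qed.

Theorem integral_power_phi m : (\int[mu]_x (x ^+ m * phi x)%:E = (nu m)%:R%:E)%E.
Proof.
elim/ltn_ind: m => -[|[|m]] IH.
- by under eq_integral do rewrite expr0 mul1r; rewrite integral_normal_pdf.
- by rewrite integral_power_phi_rec mul0e.
- by rewrite integral_power_phi_rec IH// -EFinM -natrM nuSS.
Qed.

Theorem normal_moment m : ('E_(normal_prob 0 1)[fun x : R => (x ^+ m)%R])%E = (nu m)%:R%:E.
Proof.
rewrite unlock integral_gauss; last exact: exprn_measurable.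
exact: integral_power_phi.
Qed.

End gauss.

(** * Taylor expansion of the cosine *)
Section taylor_cos.
Variable R : realType.
Implicit Types (b s x y : R).

Let is_derive_power n x : is_derive x 1 (fun y : R => y ^+ n) (n%:R * x ^+ n.-1).
Proof.
have h := @is_deriveX _ _ (@id R) n x 1 1 (is_derive_id x 1).
have -> : (fun y : R => y ^+ n) = id ^+ n by apply/funext => y; rewrite exprfctE.
apply: is_derive_eq h _.
by rewrite /GRing.scale /= mulr1.
Qed.

Let ge0_of_derive (f df : R -> R) y : (forall x, is_derive x 1 f (df x)) ->
  f 0 = 0 -> (forall x, 0 <= x -> 0 <= df x) -> 0 <= y -> 0 <= f y.
Proof.
move=> fdf f0 df0 y0.
have cf : {within `[0, y], continuous f}.
  apply: continuous_subspaceT => z.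
  by apply: differentiable_continuous; apply/derivable1_diffP; case: (fdf z).
have [c] := MVT_segment y0 (fun x _ => fdf x) cf.
by rewrite in_itv /= f0 !subr0 => /andP[c0 _] ->; rewrite mulr_ge0// df0.
Qed.

(** The j-th derivative of x |-> cos (b + s x) at 0 is
    s^j cos (b + j pi / 2). *)
Definition taylor_cos n b s x : R :=
  \sum_(j < n) cos (b + j%:R * (pi / 2)) * s ^+ j / j`!%:R * x ^+ j.

Let rest n b s x := cos (b + s * x) - taylor_cos n b s x.

Let is_derive_taylor n b s x :
  is_derive x 1 (taylor_cos n.+1 b s) (s * taylor_cos n (b + pi / 2) s x).
Proof.
elim: n => [|n IH].
  have -> : taylor_cos 1 b s = cst (cos (b + 0%:R * (pi / 2)) * s ^+ 0 / 0`!%:R).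
    by apply/funext => y; rewrite /taylor_cos big_ord1 /cst /= !expr0 mulr1.
  by rewrite /taylor_cos big_ord0 mulr0; exact: is_derive_cst.
pose c : R := cos (b + n.+1%:R * (pi / 2)) * s ^+ n.+1 / n.+1`!%:R.
have -> : taylor_cos n.+2 b s = taylor_cos n.+1 b s + (c \*: (fun y : R => y ^+ n.+1)).
  by apply/funext => y; rewrite [LHS]/taylor_cos big_ord_recr /c fctE.
apply: is_derive_eq (is_deriveD IH (is_deriveZ c (is_derive_power n.+1 x))) _.
rewrite /taylor_cos big_ord_recr /= mulrDr /GRing.scale /=; congr (_ + _).
have -> : b + pi / 2 + n%:R * (pi / 2) = b + n.+1%:R * (pi / 2).
  by rewrite -natr1; ring.
rewrite /c factS natrM exprS.
have f0 : n`!%:R != 0 :> R by rewrite pnatr_eq0 -lt0n fact_gt0.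
have n0 : n.+1%:R != 0 :> R by rewrite pnatr_eq0.
move: f0 n0; move: (n`!%:R) (n.+1%:R) (cos _) => u v w u0 v0.
by field; rewrite u0 v0.
Qed.

(** Differentiation shifts the phase by pi / 2 and lowers the order, which is the
    induction step of the remainder estimate for all phases at once. *)
Let is_derive_rest n b s x :
  is_derive x 1 (rest n.+1 b s) (s * rest n (b + pi / 2) s x).
Proof.
have hl : is_derive x 1 (cst b + (s \*: @id R)) s.
  apply: is_derive_eq (is_deriveD (is_derive_cst b x 1) (is_deriveZ s (is_derive_id x 1))) _.
  by rewrite add0r /GRing.scale /= mulr1.
have hc := is_derive1_comp (is_derive_cos _) hl.
have hr := is_deriveB hc (is_derive_taylor n b s x).
apply: is_derive_eq hr _.
rewrite /rest mulrBr -cosDpihalf mulrC; congr (_ * cos _ - _).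
by rewrite /= !fctE; exact: addrAC.
Qed.

(** Both k y^(n+1) + rest and k y^(n+1) - rest vanish at 0 and have, by
    induction, a nonnegative derivative. *)
Let rest_bound_ge0 n b s y : 0 <= y ->
  `|rest n b s y| <= `|s| ^+ n / n`!%:R * y ^+ n.
Proof.
elim: n b y => [|n IH] b y y0.
  rewrite /rest /taylor_cos big_ord0 subr0 !expr0 fact0 divr1 mulr1.
  exact: cos_max.
have f0 : n`!%:R != 0 :> R by rewrite pnatr_eq0 -lt0n fact_gt0.
have rest0 : rest n.+1 b s 0 = 0.
  rewrite /rest /taylor_cos big_ord_recl big1 => [|j _]; last by rewrite expr0n mulr0.
  by rewrite !expr0 mul0r mulr0 addr0 fact0 divr1 !mulr1 addr0 subrr.
pose k := `|s| ^+ n.+1 / n.+1`!%:R.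
have dk x : k * (n.+1%:R * x ^+ n) = `|s| * (`|s| ^+ n / n`!%:R * x ^+ n).
  rewrite /k factS natrM exprS.
  have n0 : n.+1%:R != 0 :> R by rewrite pnatr_eq0.
  move: f0 n0; move: (n`!%:R) (n.+1%:R) => u v u0 v0.
  by field; rewrite u0 v0.
have small x : 0 <= x -> `|s * rest n (b + pi / 2) s x| <= k * (n.+1%:R * x ^+ n).
  by move=> x0; rewrite dk normrM ler_wpM2l// IH.
rewrite ler_norml -subr_ge0 opprK addrC -[X in _ && X]subr_ge0 -/k; apply/andP; split.
- apply: (@ge0_of_derive ((k \*: (fun y : R => y ^+ n.+1)) + rest n.+1 b s)
    (fun x => k * (n.+1%:R * x ^+ n) + s * rest n (b + pi / 2) s x) y _ _ _ y0).
  + move=> x; exact: is_deriveD (is_deriveZ k (is_derive_power n.+1 x)) (is_derive_rest n b s x).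
  + by rewrite !fctE /= rest0 expr0n /GRing.scale /= mulr0 addr0.
  + by move=> x /small; rewrite ler_norml => /andP[+ _]; rewrite -subr_ge0 opprK addrC.
- apply: (@ge0_of_derive ((k \*: (fun y : R => y ^+ n.+1)) - rest n.+1 b s)
    (fun x => k * (n.+1%:R * x ^+ n) - s * rest n (b + pi / 2) s x) y _ _ _ y0).
  + move=> x; exact: is_deriveB (is_deriveZ k (is_derive_power n.+1 x)) (is_derive_rest n b s x).
  + by rewrite !fctE /= rest0 expr0n /GRing.scale /= mulr0 subr0.
  + by move=> x /small; rewrite ler_norml subr_ge0 => /andP[].
Qed.

(** Negative x are covered by replacing (s, x) by (- s, - x). *)
Lemma taylor_cos_bound n b s x :
  `|cos (b + s * x) - taylor_cos n b s x| <= `|s| ^+ n / n`!%:R * `|x| ^+ n.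
Proof.
have [x0|x0] := leP 0 x; first by rewrite (ger0_norm x0); exact: rest_bound_ge0.
have := @rest_bound_ge0 n b (- s) (- x); rewrite oppr_ge0 normrN => /(_ (ltW x0)).
rewrite (ltr0_norm x0) /rest mulrNN; congr (`|_ - _| <= _).
apply: eq_bigr => j _; rewrite (exprNn s) (exprNn x).
have e : (-1) ^+ j * (-1) ^+ j = 1 :> R by rewrite -exprMn mulrNN mulr1 expr1n.
move: (s ^+ j) (x ^+ j) (j`!%:R^-1) (cos _) => v w z t.
move: e; move: ((-1) ^+ j) => u e.
by transitivity (t * v * z * w * (u * u)); [ring|rewrite e mulr1].
Qed.

End taylor_cos.

(** * From moments to trigonometric polynomials *)
Section method_of_moments.
Variables (R : realType) (X : nat -> R).
Hypothesis moments : forall m, empirical_moment X m k @[k --> \oo] --> ((nu m)%:R : R).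
Local Notation gauss := (@normal_prob R 0 1).
Implicit Types f g h : R -> R.

Definition average k f : R := (\sum_(1 <= i < k.+1) f (X i)) / k%:R.

Lemma averageD k f g : average k (fun x => f x + g x) = average k f + average k g.
Proof. by rewrite /average big_split /= mulrDl. Qed.

Lemma averageZ k (c : R) f : average k (fun x => c * f x) = c * average k f.
Proof. by rewrite /average -mulr_sumr mulrA. Qed.

Lemma le_average k f g : (forall x, f x <= g x) -> average k f <= average k g.
Proof. by move=> fg; rewrite ler_wpM2r ?invr_ge0// ler_sum. Qed.

Definition gauss_mean f : R := (\int[gauss]_x f x)%R.

Definition gintegrable f : Prop := gauss.-integrable setT (EFin \o f).

Lemma gauss_meanD f g : gintegrable f -> gintegrable g ->
  gauss_mean (fun x => f x + g x) = gauss_mean f + gauss_mean g.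
Proof. by move=> fi gi; rewrite /gauss_mean RintegralD. Qed.

Lemma gauss_meanZ (c : R) f : gintegrable f -> gauss_mean (fun x => c * f x) = c * gauss_mean f.
Proof. by move=> fi; rewrite /gauss_mean RintegralZl. Qed.

Lemma le_gauss_mean f g : gintegrable f -> gintegrable g -> (forall x, f x <= g x) ->
  gauss_mean f <= gauss_mean g.
Proof. by move=> fi gi fg; apply: le_Rintegral => //; apply: fi. Qed.

Lemma gintegrableD f g : gintegrable f -> gintegrable g ->
  gintegrable (fun x => f x + g x).
Proof. by move=> fi gi; exact: (integrableD measurableT fi gi). Qed.

Lemma gintegrableZ (c : R) f : gintegrable f -> gintegrable (fun x => c * f x).
Proof. by move=> fi; exact: (integrableZl measurableT c fi). Qed.

Lemma bounded_gintegrable (M : R) f : measurable_fun setT f ->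
  (forall x, `|f x| <= M) -> gintegrable f.
Proof.
move=> mf fM; apply: measurable_bounded_integrable => //.
  apply: (@le_lt_trans _ _ 1%E); last exact: ltry.
  by rewrite le_eqVlt; apply/orP; left; apply/eqP; exact: probability_setT.
exists M; split; first exact: num_real.
by move=> N MN x _ /=; apply: le_trans (fM x) (ltW MN).
Qed.

Lemma gintegrable_power m : gintegrable (fun x => x ^+ m).
Proof.
have mX : measurable_fun setT (fun x : R => x ^+ m) by exact: exprn_measurable.
apply/integrableP; split; first exact/measurable_EFinP.
rewrite (_ : (fun x => _) = fun x => (`|x ^+ m|)%:E)//.
rewrite integral_gauss; last exact: measurableT_comp.
have /integrableP[_] := integrable_power_phi R m; apply: le_lt_trans.
rewrite le_eqVlt; apply/orP; left; apply/eqP; apply: eq_integral => x _ /=.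
by rewrite normrM (ger0_norm (normal_pdf_ge0 _ _ _)).
Qed.

Lemma gauss_mean_power m : gauss_mean (fun x => x ^+ m) = (nu m)%:R.
Proof.
by rewrite /gauss_mean /Rintegral integral_gauss ?integral_power_phi.
Qed.

Definition converges f : Prop :=
  gintegrable f /\ average k f @[k --> \oo] --> gauss_mean f.

Lemma convergesD f g : converges f -> converges g -> converges (fun x => f x + g x).
Proof.
move=> [fi fc] [gi gc]; split; first exact: gintegrableD.
rewrite gauss_meanD//; under eq_fun do rewrite averageD.
exact: cvgD.
Qed.

Lemma convergesZ (c : R) f : converges f -> converges (fun x => c * f x).
Proof.
move=> [fi fc]; split; first exact: gintegrableZ.
rewrite gauss_meanZ//; under eq_fun do rewrite averageZ.
by apply: cvgM => //; exact: cvg_cst.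
Qed.

Lemma converges_power m : converges (fun x => x ^+ m).
Proof. by split; [exact: gintegrable_power|rewrite gauss_mean_power; exact: moments]. Qed.

Lemma converges_poly n (c : nat -> R) : converges (fun x => \sum_(j < n) c j * x ^+ j).
Proof.
elim: n => [|n IH].
  rewrite (_ : (fun x => _) = fun x => 0 * x ^+ 0); last first.
    by apply/funext => x; rewrite big_ord0 mul0r.
  by apply: convergesZ; exact: converges_power.
under eq_fun do rewrite big_ord_recr.
by apply: convergesD => //; apply: convergesZ; exact: converges_power.
Qed.

(** If f is within h of g, both the averages and the Gaussian means of f and g
    differ by at most those of h, so an arbitrarily small Gaussian mean of h
    suffices. *)
Lemma converges_sandwich f : gintegrable f ->
  (forall e, 0 < e -> exists g h, [/\ converges g, converges h,
     forall x, `|f x - g x| <= h x & gauss_mean h <= e]) ->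
  converges f.
Proof.
move=> fi fgh; split => //; apply/cvgrPdist_le => e e0.
have e4 : 0 < e / 4 by rewrite divr_gt0.
have [g [h [[gi gc] [hi hc] fg he]]] := fgh _ e4.
near=> k.
have kg : `|gauss_mean g - average k g| <= e / 4.
  by near: k; move/cvgrPdist_le : gc; exact.
have kh : `|gauss_mean h - average k h| <= e / 4.
  by near: k; move/cvgrPdist_le : hc; exact.
have fle x : f x <= g x + h x by have := fg x; rewrite ler_distl => /andP[_]; rewrite addrC.
have fge x : g x <= f x + h x by have := fg x; rewrite distrC ler_distl => /andP[_]; rewrite addrC.
have a1 := le_average k fle; rewrite averageD in a1.
have a2 := le_average k fge; rewrite averageD in a2.
have m1 := le_gauss_mean fi (gintegrableD gi hi) fle; rewrite gauss_meanD// in m1.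
have m2 := le_gauss_mean gi (gintegrableD fi hi) fge; rewrite gauss_meanD// in m2.
move: kg kh; rewrite !ler_norml => /andP[? ?] /andP[? ?].
by apply/andP; split; lra.
Unshelve. all: end_near. Qed.

Lemma nu_double N : (nu N.*2 * (2 ^ N * N`!))%N = (N.*2)`!.
Proof.
elim: N => [//|N IH]; rewrite doubleS nuSS !factS expnS -IH.
rewrite (_ : N.*2.+2 = 2 * N.+1)%N; last by lia.
by move: (nu _) (2 ^ N)%N (N`!) (N.*2.+1) (N.+1) => a b c d f; lia.
Qed.

(** The remainder of the Taylor polynomial of degree below 2 N has Gaussian mean
    at most s^(2 N) nu (2 N) / (2 N)! = (s^2 / 2)^N / N!, a null sequence.  This
    growth condition on the moments is what makes the normal law determined by
    them. *)
Lemma converges_cos b s : converges (fun x => cos (b + s * x)).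
Proof.
apply: converges_sandwich.
  apply: (@bounded_gintegrable 1) => [|x]; last exact: cos_max.
  apply: continuous_measurable_fun => x; apply: continuous_comp; last exact: continuous_cos.
  apply: cvgD; first exact: cvg_cst.
  by apply: cvgM; [exact: cvg_cst|exact: cvg_id].
move=> e e0.
have /cvgrPdist_le/(_ _ e0) [N _ Ne] := cvg_exp_coeff (s ^+ 2 / 2).
exists (taylor_cos N.*2 b s), (fun x => `|s| ^+ N.*2 / N.*2`!%:R * x ^+ N.*2); split.
- by rewrite /taylor_cos; exact: (converges_poly _ (fun j => cos (b + j%:R * (pi / 2)) * s ^+ j / j`!%:R)).
- by apply: convergesZ; exact: converges_power.
- move=> x; have := taylor_cos_bound N.*2 b s x.
  by rewrite -(normrX _ x) (@ger0_norm _ (x ^+ _)) ?exprn_even_ge0 ?odd_double.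
rewrite gauss_meanZ ?gauss_mean_power; last exact: gintegrable_power.
have := Ne N (leqnn N); rewrite /= sub0r normrN; apply: le_trans.
apply: le_trans (ler_norm _); rewrite le_eqVlt; apply/orP; left; apply/eqP.
have -> : `|s| ^+ N.*2 = (s ^+ 2) ^+ N by rewrite -mul2n exprM real_normK ?num_real.
rewrite /exp_coeff /= -(nu_double N) !natrM.
have f0 : N`!%:R != 0 :> R by rewrite pnatr_eq0 -lt0n fact_gt0.
have n0 : (nu N.*2)%:R != 0 :> R.
  have := fact_gt0 N.*2; rewrite -(nu_double N) muln_gt0 => /andP[+ _].
  by rewrite pnatr_eq0 -lt0n.
rewrite natrX expr_div_n; field.
by rewrite n0 f0 expf_neq0.
Qed.

(** Spanned by cosines with a phase, so that a product of two generators is again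
    a combination of generators. *)
Inductive trig : (R -> R) -> Prop :=
| trig_cos b s : trig (fun x => cos (b + s * x))
| trig_scale c f : trig f -> trig (fun x => c * f x)
| trig_add f g : trig f -> trig g -> trig (fun x => f x + g x).

Lemma trig_converges f : trig f -> converges f.
Proof.
elim=> [b s|c g _|g h _ gc _]; first exact: converges_cos.
  exact: convergesZ.
exact: convergesD.
Qed.

Lemma trig_cst c : trig (fun=> c).
Proof.
have := trig_scale c (trig_cos 0 0).
by under eq_fun do rewrite mul0r addr0 cos0 mulr1.
Qed.

Let trig_mul_cos b s g : trig g -> trig (fun x => cos (b + s * x) * g x).
Proof.
elim=> [b' s'|c f _ IH|f h _ IHf _ IHh].
- have -> : (fun x => cos (b + s * x) * cos (b' + s' * x)) = (fun x =>
      2^-1 * (cos ((b - b') + (s - s') * x) + cos ((b + b') + (s + s') * x))).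
    apply/funext => x.
    have -> : b - b' + (s - s') * x = (b + s * x) - (b' + s' * x) by ring.
    have -> : b + b' + (s + s') * x = (b + s * x) + (b' + s' * x) by ring.
    by move: (b + _) (b' + _) => u v; rewrite cosB cosD; field.
  by apply: trig_scale; apply: trig_add; exact: trig_cos.
- by under eq_fun do rewrite mulrCA; exact: trig_scale.
- by under eq_fun do rewrite mulrDr; exact: trig_add.
Qed.

Lemma trig_mul f g : trig f -> trig g -> trig (fun x => f x * g x).
Proof.
move=> + tg; elim=> [b s|c h _ IH|h1 h2 _ IH1 _ IH2]; first exact: trig_mul_cos.
- by under eq_fun do rewrite -mulrA; exact: trig_scale.
- by under eq_fun do rewrite mulrDl; exact: trig_add.
Qed.

Lemma trig_exp f n : trig f -> trig (fun x => f x ^+ n).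
Proof.
move=> tf; elim: n => [|n IH]; first by under eq_fun do rewrite expr0; exact: trig_cst.
by under eq_fun do rewrite exprS; exact: trig_mul.
Qed.

Lemma trig_sin s : trig (fun x => sin (s * x)).
Proof.
have := trig_cos (- (pi / 2)) s.
by under eq_fun do rewrite addrC cosBpihalf.
Qed.

End method_of_moments.

(** * Trigonometric approximation of step functions *)
Section smooth_step.
Variable R : realType.

Lemma bernoulli_ineq (y : R) M : 0 <= y <= 1 ->
  1 - M%:R * y <= (1 - y) ^+ M /\ (1 - y) ^+ M * (M%:R * y) <= 1.
Proof.
move=> /andP[y0 y1]; have z0 : 0 <= 1 - y by rewrite subr_ge0.
suff [h1 h2] : 1 - M%:R * y <= (1 - y) ^+ M /\ (1 - y) ^+ M * (1 + M%:R * y) <= 1.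
  split => //; apply: le_trans h2; rewrite ler_wpM2l ?exprn_ge0//.
  by rewrite lerDr.
elim: M => [|M [IH1 IH2]]; first by rewrite !expr0 mul0r subr0 addr0 mulr1.
have p0 : 0 <= M%:R * y ^+ 2 by rewrite mulr_ge0 ?sqr_ge0.
have q0 : 0 <= y ^+ 2 by exact: sqr_ge0.
rewrite -natr1 exprSr; split.
  by apply: le_trans (ler_wpM2r z0 IH1); lra.
apply: le_trans IH2; rewrite -mulrA ler_wpM2l ?exprn_ge0//; lra.
Qed.

(** The polynomial (1 - v^n)^M with M about rho^n has its jump at v = 1 / rho: by
    Bernoulli's inequality it is at least 1 - (rho v)^n and at most (rho v)^-n, up
    to constants. *)
Lemma power_step (va vb e : R) : 0 < va -> va < vb -> vb <= 1 -> 0 < e ->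
  exists n M, forall v, 0 <= v <= 1 ->
    [/\ 0 <= (1 - v ^+ n) ^+ M <= 1, (v <= va -> 1 - e <= (1 - v ^+ n) ^+ M)
      & (vb <= v -> (1 - v ^+ n) ^+ M <= e)].
Proof.
move=> va0 vab vb1 e0; pose c := (va + vb) / 2.
have vb0 : 0 < vb := lt_trans va0 vab.
have c0 : 0 < c by rewrite divr_gt0// addr_gt0.
have [vac cvb] : va < c /\ c < vb by rewrite /c; split; lra.
have c1 : c <= 1 by rewrite (le_trans (ltW cvb)).
have small (p q : R) (d : R) : 0 < p -> p < q -> 0 < d -> \forall n \near \oo, (p / q) ^+ n <= d.
  move=> p0 pq d0; have q0 := lt_trans p0 pq.
  have h : `|p / q| < 1 by rewrite ger0_norm ?divr_ge0 ?ltW// ltr_pdivrMr// mul1r.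
  have /cvgrPdist_le/(_ _ d0) := cvg_expr h.
  apply: filterS => n; rewrite sub0r normrN; apply: le_trans; exact: ler_norm.
have e2 : 0 < e / 2 by rewrite divr_gt0.
have [n [n1 n2]] : exists n, (va / c) ^+ n <= e / 2 /\ (c / vb) ^+ n <= e.
  near \oo => n; exists n; split; near: n; exact: small.
pose rho := c^-1 ^+ n; have rho1 : 1 <= rho by rewrite exprn_ege1// invf_ge1.
have [M M1 M2] : exists2 M : nat, rho <= M%:R & M%:R <= 2 * rho.
  exists (Num.truncn rho).+1; first by rewrite ltW// truncnS_gt.
  have /truncn_itv/andP[h _] : 0 <= rho by rewrite (le_trans ler01).
  by rewrite -natr1; lra.
exists n, M => v /andP[v0 v1].
have y0 : 0 <= v ^+ n by rewrite exprn_ge0.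
have y1 : v ^+ n <= 1 by rewrite exprn_ile1.
have z0 : 0 <= 1 - v ^+ n by rewrite subr_ge0.
have [b1 b2] : 1 - M%:R * v ^+ n <= (1 - v ^+ n) ^+ M /\
    (1 - v ^+ n) ^+ M * (M%:R * v ^+ n) <= 1 by apply: bernoulli_ineq; rewrite y0.
split.
- by rewrite exprn_ge0//= exprn_ile1// gerBl.
- move=> vva; apply: le_trans b1; rewrite lerD2l lerN2.
  apply: (@le_trans _ _ (2 * (va / c) ^+ n)); last by lra.
  rewrite exprMn [va ^+ n * _]mulrC mulrA; apply: ler_pM => //.
  by rewrite lerXn2r ?nnegrE// ltW.
move=> vbv; apply: le_trans n2; pose w := (vb / c) ^+ n.
have w0 : 0 < w by rewrite exprn_gt0// divr_gt0.
have -> : (c / vb) ^+ n = w^-1 by rewrite /w -exprVn invf_div.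
rewrite -(ler_pM2r w0) mulVf ?gt_eqF//; apply: le_trans b2.
rewrite ler_wpM2l ?exprn_ge0// /w exprMn mulrC; apply: ler_pM => //.
- by rewrite exprn_ge0// invr_ge0 ltW.
- by rewrite exprn_ge0// ltW.
- by rewrite lerXn2r ?nnegrE// ltW.
Unshelve. all: end_near. Qed.

(** On [-L, L] the function v = (1 + sin (x / L)) / 2 increases, since 1 <= pi / 2,
    and [power_step] applies to v a < v b.  Outside, L was chosen so that
    e x^2 >= 1, and the trivial bounds 0 <= p <= 1 suffice. *)
Lemma trig_step (a b e : R) : a < b -> 0 < e -> exists p : R -> R, trig p /\
  forall x : R, (x <= a)%R%:R <= p x + e * (1 + x ^+ 2) /\
            p x <= (x <= b)%R%:R + e * (1 + x ^+ 2).
Proof.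
move=> ab e0; pose L := 1 + `|a| + `|b| + e^-1.
have ei0 : 0 < e^-1 by rewrite invr_gt0.
have [na nb] : 0 <= `|a| /\ 0 <= `|b| by [].
have L1 : 1 <= L by rewrite /L; lra.
have L0 : 0 < L by lra.
have Le : 1 <= e * L ^+ 2.
  have h : e^-1 <= L by rewrite /L; lra.
  have : e^-1 * 1 <= L * L by apply: ler_pM => //; exact: ltW.
  by rewrite mulr1 -expr2 => h2; rewrite -ler_pdivrMl ?mulr1.
pose v x := (1 + sin (L^-1 * x)) / 2.
have v01 x : 0 <= v x <= 1.
  rewrite /v; have := sin_max (L^-1 * x); rewrite ler_norml => /andP[? ?].
  by apply/andP; split; lra.
have itvL x : `|x| <= L -> L^-1 * x \in `[- (pi / 2), pi / 2].
  rewrite in_itv /= -ler_norml normrM gtr0_norm ?invr_gt0// mulrC => xL.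
  by apply: le_trans (pihalf_ge1 R); rewrite ler_pdivrMr// mul1r.
have aL : `|a| <= L by rewrite /L; lra.
have bL : `|b| <= L by rewrite /L; lra.
have v_homo x y : `|x| <= L -> `|y| <= L -> x <= y -> v x <= v y.
  move=> xL yL; rewrite le_eqVlt => /orP[/eqP-> //|xy].
  rewrite ltW// /v ltr_pM2r// ltrD2l ltr_sin ?itvL//.
  by rewrite ltr_pM2l ?invr_gt0.
have vab : v a < v b.
  by rewrite /v ltr_pM2r// ltrD2l ltr_sin ?itvL// ltr_pM2l ?invr_gt0.
have va0 : 0 < v a.
  have : v (- L) < v a.
    have NL : `|- L| <= L by rewrite normrN gtr0_norm.
    rewrite /v ltr_pM2r// ltrD2l ltr_sin; [|exact: itvL..].
    rewrite ltr_pM2l ?invr_gt0//.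
    by have := ler_norm (- a); rewrite normrN /L; lra.
  by apply: le_lt_trans; have /andP[] := v01 (- L).
have vb1 : v b <= 1 by have /andP[] := v01 b.
have [n [M nM]] := power_step va0 vab vb1 e0.
exists (fun x => (1 - v x ^+ n) ^+ M); split.
  apply: trig_exp; apply: trig_add; first exact: trig_cst.
  have -> : (fun x => - v x ^+ n) = (fun x => -1 * v x ^+ n).
    by apply/funext => x; rewrite mulN1r.
  apply: trig_scale; apply: trig_exp; rewrite /v.
  under eq_fun do rewrite mulrC.
  by apply: trig_scale; apply: trig_add; [exact: trig_cst|exact: trig_sin].
move=> x; have [/andP[p0 p1] pa pb] := nM _ (v01 x).
have ex2 : 0 <= e * x ^+ 2 by rewrite mulr_ge0 ?sqr_ge0// ltW.
have [xL|Lx] := leP `|x| L; last first.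
  have h : 1 <= e * x ^+ 2.
    apply: le_trans Le _; rewrite ler_pM2l// -(real_normK (num_real x)).
    by rewrite lerXn2r ?nnegrE // ltW.
  have h01 (c : bool) : 0 <= c%:R :> R /\ c%:R <= 1 :> R by case: c.
  have [[_ a1] [b0 _]] := (h01 (x <= a), h01 (x <= b)).
  by clear - p0 p1 h a1 b0 e0; split; lra.
split.
  have [xa|_] := leP x a; last by clear - p0 ex2 e0; rewrite /=; lra.
  by have := pa (v_homo _ _ xL aL xa); clear - ex2 e0; rewrite /=; lra.
have [_|bx] := leP x b; first by clear - p1 ex2 e0; rewrite /=; lra.
by have := pb (v_homo _ _ bL xL (ltW bx)); clear - ex2 e0; rewrite /=; lra.
Qed.

End smooth_step.

(** * Convergence of the distribution functions *)
Section distribution_functions.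
Variables (R : realType) (X : nat -> R).
Hypothesis moments : forall m, empirical_moment X m k @[k --> \oo] --> ((nu m)%:R : R).
Local Notation gauss := (@normal_prob R 0 1).
Local Notation Phi := (@normal_cdf R).
Local Notation F := (empirical_cdf X).

Lemma empirical_cdf_average k t : F k t = average X k (fun x => (x <= t)%R%:R).
Proof.
rewrite /empirical_cdf /average big_add1 /= big_mkord; congr (_ / _).
rewrite -sum1_card natr_sum big_mkcond /=; apply: eq_bigr => i _.
by rewrite inE; case: (_ <= t).
Qed.

Let below (t : R) : (fun x => (x <= t)%R%:R : R) = \1_(`]-oo, t]%classic).
Proof. by apply/funext => x; rewrite indicE mem_setE in_itv. Qed.

Let gintegrable_below t : gintegrable (fun x : R => (x <= t)%R%:R).
Proof.
apply: (@bounded_gintegrable _ 1) => [|x]; last by rewrite ger0_norm// lern1 leq_b1.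
by rewrite below; exact: measurable_indic.
Qed.

Lemma normal_cdf_gauss_mean t : Phi t = gauss_mean (fun x => (x <= t)%R%:R).
Proof.
rewrite below /normal_cdf /gauss_mean /Rintegral; congr fine.
by rewrite integral_indic// setIT.
Qed.

Let q (x : R) := 1 + x ^+ 2.

Let converges_q : converges X q.
Proof.
have := convergesD (converges_power moments 0) (converges_power moments 2).
by under [X in converges _ X]eq_fun do rewrite expr0.
Qed.

Let gauss_mean_q : gauss_mean q = 2.
Proof.
have -> : q = (fun x => x ^+ 0 + x ^+ 2) by apply/funext => x; rewrite expr0.
rewrite gauss_meanD ?gauss_mean_power; [by rewrite -natrD|exact: gintegrable_power..].
Qed.

(** Averages and Gaussian means of the step approximation are asymptotically
    equal, and the error terms have the Gaussian mean 2 of 1 + x^2. *)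
Let cdf_sandwich (a b e : R) : a < b -> 0 < e -> 
  (\forall k \near \oo, F k a <= Phi b + e) /\ (\forall k \near \oo, Phi a - e <= F k b).
Proof.
move=> ab e0; have e8 : 0 < e / 8 by rewrite divr_gt0.
have [p [tp pP]] := trig_step ab e8.
have [pi pc] := trig_converges moments tp.
have [qi qc] := converges_q; rewrite gauss_mean_q in qc.
have eqi : gintegrable (fun x => e / 8 * q x) by exact: gintegrableZ.
have m1 : Phi a <= gauss_mean p + e / 4.
  rewrite normal_cdf_gauss_mean; apply: (@le_trans _ _ (gauss_mean (fun x => p x + e / 8 * q x))).
    by apply: le_gauss_mean => //; [exact: gintegrableD|move=> x; case: (pP x)].
  by rewrite gauss_meanD// gauss_meanZ// gauss_mean_q; lra.
have m2 : gauss_mean p <= Phi b + e / 4.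
  rewrite normal_cdf_gauss_mean; apply: (@le_trans _ _ (gauss_mean (fun x => (x <= b)%R%:R + e / 8 * q x))).
    by apply: le_gauss_mean => //; [exact: gintegrableD|move=> x; case: (pP x)].
  by rewrite gauss_meanD// gauss_meanZ// gauss_mean_q; lra.
have a1 k : F k a <= average X k p + e / 8 * average X k q.
  rewrite empirical_cdf_average -averageZ -averageD; apply: le_average => x.
  by case: (pP x).
have a2 k : average X k p <= F k b + e / 8 * average X k q.
  rewrite empirical_cdf_average -averageZ -averageD; apply: le_average => x.
  by case: (pP x).
have kp : \forall k \near \oo, `|gauss_mean p - average X k p| <= e / 4.
  by move/cvgrPdist_le : pc; apply; rewrite divr_gt0.
have kq : \forall k \near \oo, average X k q <= 3.
  have /cvgrPdist_le/(_ _ ltr01) := qc; apply: filterS => k.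
  by rewrite ler_norml => /andP[? ?]; lra.
split; near=> k.
- have h1 : `|gauss_mean p - average X k p| <= e / 4 by near: k.
  have h2 : e / 8 * average X k q <= e / 8 * 3 by rewrite ler_pM2l//; near: k.
  by have := a1 k; move: h1; rewrite ler_norml => /andP[? ?]; lra.
- have h1 : `|gauss_mean p - average X k p| <= e / 4 by near: k.
  have h2 : e / 8 * average X k q <= e / 8 * 3 by rewrite ler_pM2l//; near: k.
  by have := a2 k; move: h1; rewrite ler_norml => /andP[? ?]; lra.
Unshelve. all: end_near. Qed.

Let gauss_itv (a b : R) : a < b ->
  (gauss `]a, b] <= (normal_peak 1 * (b - a))%:E)%E.
Proof.
move=> ab; rewrite /normal_prob.
apply: (@le_trans _ _ (\int[lebesgue_measure]_(x in `]a, b]) (normal_peak (1 : R))%:E)%E).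
  apply: ge0_le_integral => //.
  - by move=> x _; rewrite lee_fin normal_pdf_ge0.
  - by apply/measurable_EFinP; apply: measurable_funTS; exact: measurable_normal_pdf.
  - by move=> x _; rewrite lee_fin normal_pdf_ub// oner_neq0.
rewrite integral_cst//= lebesgue_measure_itv/= lte_fin ab.
by rewrite -EFinB -EFinM.
Qed.

Let Phi_le (a b : R) : a <= b -> Phi a <= Phi b.
Proof.
move=> ab; rewrite !normal_cdf_gauss_mean; apply: le_gauss_mean => // x.
by rewrite ler_nat; case: leP => // xa; rewrite (le_trans xa ab).
Qed.

Let Phi_lipschitz (a b : R) : a <= b -> Phi b <= Phi a + normal_peak 1 * (b - a).
Proof.
rewrite le_eqVlt => /orP[/eqP->|ab]; first by rewrite subrr mulr0 addr0.
have fin t : gauss `]-oo, t] \is a fin_num by exact: fin_num_measure.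
have h : (gauss `]-oo, b] <= gauss `]-oo, a] + (normal_peak 1 * (b - a))%:E)%E.
  have hU : `]-oo, b]%classic = `]-oo, a]%classic `|` `]a, b]%classic :> set R.
    by rewrite -itv_bndbnd_setU// bnd_simp ltW.
  apply: (@le_trans _ _ (gauss `]-oo, a] + gauss `]a, b])%E).
    by rewrite hU; apply: measureU2; exact: measurable_itv.
  by rewrite leeD2l// gauss_itv.
rewrite /normal_cdf -lee_fin EFinD !fineK//; exact: fin.
Qed.

Let cst_power (c : R) : (fun=> c) = (fun x : R => c * x ^+ 0).
Proof. by apply/funext => x; rewrite expr0 mulr1. Qed.

Let gauss_mean_cst (c : R) : gauss_mean (fun=> c) = c.
Proof.
rewrite cst_power gauss_meanZ ?gauss_mean_power; last exact: gintegrable_power.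
exact: mulr1.
Qed.

Let gintegrable_cst (c : R) : gintegrable (fun=> c).
Proof. by rewrite cst_power; apply: gintegrableZ; exact: gintegrable_power. Qed.

Let Phi01 t : 0 <= Phi t <= 1.
Proof.
rewrite normal_cdf_gauss_mean; apply/andP; split.
  by rewrite -(gauss_mean_cst 0); apply: le_gauss_mean => // x; case: (x <= t).
by rewrite -[leRHS](gauss_mean_cst 1); apply: le_gauss_mean => // x; case: (x <= t).
Qed.

(** Chebyshev's inequality. *)
Let Phi_tails (L : R) : 0 < L -> Phi (- L) <= L^-2 /\ 1 - L^-2 <= Phi L.
Proof.
move=> L0; have L2 : 0 < L ^- 2 by rewrite invr_gt0 exprn_gt0.
have qi : gintegrable (fun x => L ^- 2 * x ^+ 2) by apply: gintegrableZ; exact: gintegrable_power.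
have qm : gauss_mean (fun x => L ^- 2 * x ^+ 2) = L ^- 2.
  by rewrite gauss_meanZ ?gauss_mean_power ?mulr1//; exact: gintegrable_power.
have big x : L <= `|x| -> 1 <= L ^- 2 * x ^+ 2.
  move=> Lx; rewrite ler_pdivlMl ?exprn_gt0// mulr1 -(real_normK (num_real x)).
  by rewrite lerXn2r ?nnegrE// ltW.
have nn x : 0 <= L ^- 2 * x ^+ 2 by rewrite mulr_ge0 ?sqr_ge0// ltW.
rewrite !normal_cdf_gauss_mean; split.
  rewrite -[X in _ <= X]qm; apply: le_gauss_mean => // x.
  case: (leP x (- L)) => //= xL; apply: big.
  by rewrite ler_normr lerNr xL orbT.
rewrite lerBlDr -[X in X <= _](gauss_mean_cst 1) -[X in _ <= _ + X]qm -gauss_meanD//.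
apply: le_gauss_mean => //; first exact: gintegrableD.
move=> x; case: (leP x L) => /= xL; first by rewrite lerDl.
by rewrite add0r; apply: big; rewrite ler_normr ltW.
Qed.

Let F_le k (a b : R) : a <= b -> F k a <= F k b.
Proof.
move=> ab; rewrite !empirical_cdf_average; apply: le_average => // x.
by rewrite ler_nat; case: leP => // xa; rewrite (le_trans xa ab).
Qed.

Let F01 k t : 0 <= F k t <= 1.
Proof.
rewrite /empirical_cdf divr_ge0//=; have [->|k0] := posnP k.
  by rewrite invr0 mulr0.
rewrite ler_pdivrMr ?ltr0n// mul1r ler_nat.
by rewrite -[X in (_ <= X)%N]card_ord max_card.
Qed.

Lemma cvg_empirical_cdf t : F k t @[k --> \oo] --> Phi t.
Proof.
apply/cvgrPdist_le => e e0; have e2 : 0 < e / 2 by rewrite divr_gt0.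
have P0 : 0 < normal_peak (1 : R) by rewrite normal_peak_gt0// oner_neq0.
pose d := e / 2 / normal_peak 1; have d0 : 0 < d by rewrite divr_gt0.
have Pd : normal_peak 1 * d = e / 2 by rewrite mulrC divfK// gt_eqF.
have td : t < t + d by rewrite ltrDl.
have dt : t - d < t by rewrite gtrBl.
have [up _] := cdf_sandwich td e2; have [_ low] := cdf_sandwich dt e2.
near=> k.
have h1 : F k t <= Phi (t + d) + e / 2 by near: k.
have h2 : Phi (t - d) - e / 2 <= F k t by near: k.
have := Phi_lipschitz (ltW td); have := Phi_lipschitz (ltW dt).
have -> : t - (t - d) = d by ring.
have -> : t + d - t = d by ring.
rewrite Pd => h3 h4.
by rewrite ler_norml; apply/andP; split; lra.
Unshelve. all: end_near. Qed.

(** A finite grid of mesh d from -L to beyond L: neighbouring grid points have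
    values of Phi at distance at most e / 2, beyond the ends Phi is within e / 2
    of 0 or 1, and monotonicity interpolates. *)
Lemma uniform_cvg_empirical_cdf (e : R) : 0 < e ->
  \forall k \near \oo, forall t, `|F k t - Phi t| <= e.
Proof.
move=> e0; have e2 : 0 < e / 2 by rewrite divr_gt0.
have P0 : 0 < normal_peak (1 : R) by rewrite normal_peak_gt0// oner_neq0.
pose d := e / 2 / normal_peak 1; have d0 : 0 < d by rewrite divr_gt0.
have Pd : normal_peak 1 * d = e / 2 by rewrite mulrC divfK// gt_eqF.
pose L := 1 + (e / 2)^-1.
have i0 : 0 < (e / 2)^-1 by rewrite invr_gt0.
have L1 : 1 <= L by rewrite lerDl ltW.
have L0 : 0 < L by rewrite (lt_le_trans ltr01).
have Le : L ^- 2 <= e / 2.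
  rewrite -[e / 2]invrK lef_pV2 ?posrE ?exprn_gt0//.
  by rewrite (@le_trans _ _ L) ?lerDr// expr2 ler_peMl// ltW.
have [Phi_low Phi_high] := Phi_tails L0.
pose N := (Num.truncn (2 * L / d)).+1.
pose g j : R := - L + j%:R * d.
have gN : L <= g N.
  have : 2 * L <= N%:R * d by rewrite -ler_pdivrMr// ltW// truncnS_gt.
  by rewrite /g; lra.
have /boolp.choice[K KP] : forall j, exists K, forall k, (K <= k)%N ->
    `|Phi (g j) - F k (g j)| <= e / 2.
  by move=> j; have /cvgrPdist_le/(_ _ e2) [K _ KP] := @cvg_empirical_cdf (g j); exists K.
exists (\max_(j < N.+1) K j) => // k /= Kk t.
have near_grid j : (j <= N)%N -> Phi (g j) - e / 2 <= F k (g j) <= Phi (g j) + e / 2.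
  move=> jN; have jN' : (j < N.+1)%N by [].
  have := KP j k (leq_trans (leq_bigmax (Ordinal jN')) Kk).
  by rewrite distrC ler_distl.
have /andP[F0 F1] := F01 k t; have /andP[Phi0 Phi1] := Phi01 t.
rewrite ler_distl.
have [tL|Lt] := ltP t (- L).
  have := near_grid 0%N isT; rewrite /g mul0r addr0 => /andP[_ h].
  have := F_le k (ltW tL); have := Phi_le (ltW tL).
  by move=> ? ?; apply/andP; split; lra.
have [tN|Nt] := ltP t (g N); last first.
  have := near_grid N (leqnn N) => /andP[h _].
  have := F_le k Nt; have := Phi_le Nt; have := Phi_le gN.
  by move=> ? ? ?; apply/andP; split; lra.
pose j := Num.truncn ((t + L) / d).
have /truncn_itv/andP[] : 0 <= (t + L) / d by rewrite divr_ge0 ?(ltW d0)// -lerBlDr sub0r.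
rewrite -/j ler_pdivlMr// ltr_pdivrMr// => j1 j2.
have gj : g j <= t by rewrite /g; lra.
have gj1 : t <= g j.+1 by rewrite /g; lra.
have jN : (j < N)%N.
  rewrite -(ltr_nat R) -(ltr_pM2r d0); move: tN; rewrite /g; lra.
have /andP[h1 _] := near_grid j (ltnW jN); have /andP[_ h2] := near_grid j.+1 jN.
have h3 := F_le k gj; have h4 := F_le k gj1.
have gg : g j <= g j.+1 by rewrite (le_trans gj).
have := Phi_lipschitz gg; rewrite (_ : g j.+1 - g j = d) ?Pd => [h5|]; last first.
  by rewrite /g -natr1; ring.
have h6 := Phi_le gj; have h7 := Phi_le gj1.
by apply/andP; split; lra.
Qed.

Theorem cvg_sup_empirical_cdf :
  ereal_sup (range (fun t : R => `|F k t - Phi t|%:E)) @[k --> \oo] --> 0%E.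
Proof.
have sup_le e k : (forall t, `|F k t - Phi t| <= e) ->
    (ereal_sup (range (fun t : R => `|F k t - Phi t|%:E)) <= e%:E)%E.
  by move=> h; apply: ge_ereal_sup => _ [t _ <-]; rewrite lee_fin.
have sup_ge0 k : (0 <= ereal_sup (range (fun t : R => `|F k t - Phi t|%:E)))%E.
  apply: le_trans (ereal_sup_ubound _); last by exists 0.
  by rewrite lee_fin.
apply/fine_cvgP; split.
  apply: filterS (uniform_cvg_empirical_cdf ltr01) => k h.
  by rewrite ge0_fin_numE// (le_lt_trans (sup_le _ _ h)) ?ltry.
apply/cvgrPdist_le => e e0; apply: filterS (uniform_cvg_empirical_cdf e0) => k h.
rewrite sub0r normrN ger0_norm ?fine_ge0//=.
have fin : ereal_sup (range (fun t : R => `|F k t - Phi t|%:E)) \is a fin_num.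
  by rewrite ge0_fin_numE// (le_lt_trans (sup_le _ _ h)) ?ltry.
by rewrite -lee_fin fineK// sup_le.
Qed.

End distribution_functions.

Theorem mainTheorem2 (R : realType) (omega : nat -> bool) :
  schnorr_random R omega ->
  let X : nat -> R := normalized_block_sum R omega in
  (forall m : nat,
     [/\ forall k : nat, (0 < k)%N ->
           (\int[empirical_law X k]_x (x ^+ m)%:E)%E
             = (empirical_moment X m k)%:E,
         empirical_moment X m k @[k --> \oo] --> ((nu m)%:R : R)
       & ('E_(normal_prob 0 1)[fun x : R => (x ^+ m)%R])%E = (nu m)%:R%:E]) /\
  ereal_sup (range (fun t : R =>
      `| empirical_cdf X k t - normal_cdf t |%:E)) @[k --> \oo] --> 0%E.
Proof.
move=> rnd X; have moments := cvg_empirical_moment rnd.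
split=> [m|]; last exact: cvg_sup_empirical_cdf.
split=> [k _||]; [|exact: moments|exact: normal_moment].
by rewrite integral_empirical_law//; exact: exprn_measurable.
Qed.
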